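(* A finite directed graph $\vec H$ is impartial if and only if it is a disjoint union of recursively bridge-mirrored digraphs.
   Context: A digraph $\vec H$ has a finite vertex set $V(H)$ and edge set $E(\vec H)$ of ordered pairs $(u,v)$; $H$ denotes its underlying undirected graph and $|H|$ its number of vertices. A digraph $\vec H$ is called impartial if there is some $n \ge |H|$ such that all $n$-vertex tournaments contain the same number of copies of $\vec H$ as subgraphs (with orientations respected). A digraph is recursively bridge-mirrored if it can be built by the following rules: (i) the tree with one vertex is recursively bridge-mirrored; (ii) if $\vec T$ is recursively bridge-mirrored, mark an arbitrary vertex of $\vec T$ as its root, take two identical copies of this rooted $\vec T$, and add a new directed edge from one root to the other; the result is recursively bridge-mirrored.
   Formalization: Digraphs are taken without loops and without pairs of opposite edges; a digraph with either has no copy in any tournament, so it is impartial but is not a disjoint union of recursively bridge-mirrored digraphs. *)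

(* Defs.v *)
From mathcomp Require Import all_boot.

Set Implicit Arguments.
Unset Strict Implicit.
Unset Printing Implicit Defensive.

(* Finite digraphs are orientations of simple graphs: [edge_asym] excludes
   loops and pairs of opposite edges.  A digraph with one of these has no copy
   in any tournament, so it would be impartial for a degenerate reason. *)
Record digraph := Digraph {
  vertex :> finType;
  edge : rel vertex;
  edge_asym : forall u v : vertex, edge u v -> ~~ edge v u }.

Definition tournament (T : digraph) : Prop :=
  forall u v : T, u != v -> edge u v (+) edge v u.

Definition isomorphic (G H : digraph) : Prop :=
  exists f : G -> H, bijective f /\ forall u v : G, edge (f u) (f v) = edge u v.

(* A subgraph of [G] is a pair (vertex set, edge set); it need be neither
   induced nor spanning. *)
Definition is_subgraph (G : digraph) (K : {set G} * {set G * G}) : bool :=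
  [forall e in K.2, [&& e.1 \in K.1, e.2 \in K.1 & edge e.1 e.2]].

Definition is_copy (H G : digraph) (K : {set G} * {set G * G}) : bool :=
  is_subgraph K &&
  [exists f : {ffun H -> G},
    [&& injectiveb f, f @: [set: H] == K.1 &
        [forall u, forall v, ((f u, f v) \in K.2) == edge u v]]].

(* Unlabelled copies: subgraphs isomorphic to [H], not embeddings of [H]. *)
Definition num_copies (H G : digraph) : nat :=
  #|[set K : {set G} * {set G * G} | is_copy H K]|.

Definition impartial (H : digraph) : Prop :=
  exists2 n : nat, #|H| <= n &
    forall T1 T2 : digraph,
      tournament T1 -> tournament T2 -> #|T1| = n -> #|T2| = n ->
      num_copies H T1 = num_copies H T2.

Section BridgeMirror.
Variables (T : digraph) (r : T).

Definition bridge_mirror_edge : rel (bool * T) := fun u v =>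
  ((u.1 == v.1) && edge u.2 v.2) || ((u == (false, r)) && (v == (true, r))).

Lemma bridge_mirror_asym (u v : bool * T) :
  bridge_mirror_edge u v -> ~~ bridge_mirror_edge v u.
Proof.
case: u v => [b x] [c y]; rewrite /bridge_mirror_edge !xpair_eqE /=.
case/orP=> [/andP[/eqP-> /edge_asym/negbTE->]|]; first by case: c; rewrite ?andbF.
by case/andP=> /andP[/eqP-> _] /andP[/eqP-> _].
Qed.

Definition bridge_mirror : digraph := Digraph bridge_mirror_asym.

End BridgeMirror.

(* The two copies of the rooted [T] are interchangeable, so fixing the
   direction of the new edge loses nothing up to isomorphism. *)
Inductive recursively_bridge_mirrored : digraph -> Prop :=
  | rbm_vertex (H : digraph) : #|H| = 1 -> recursively_bridge_mirrored H
  | rbm_bridge (T : digraph) (r : T) (H : digraph) :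
      recursively_bridge_mirrored T -> isomorphic H (bridge_mirror r) ->
      recursively_bridge_mirrored H.

Section DisjointUnion.
Variables (k : nat) (F : 'I_k -> digraph).

Definition disjoint_union_edge : rel {i : 'I_k & vertex (F i)} := fun u v =>
  (tag u == tag v) && edge (tagged u) (tagged_as u v).

Lemma disjoint_union_asym (u v : {i : 'I_k & vertex (F i)}) :
  disjoint_union_edge u v -> ~~ disjoint_union_edge v u.
Proof.
case: u v => [i x] [j y] /andP[/= /eqP eij]; case: j / eij y => y.
by rewrite /disjoint_union_edge /= !tagged_asE eqxx; apply: edge_asym.
Qed.

Definition disjoint_union : digraph := Digraph disjoint_union_asym.

End DisjointUnion.

(* The empty union [k = 0] accounts for the digraph with no vertices. *)
Definition is_disjoint_union_of_rbm (H : digraph) : Prop :=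
  exists (k : nat) (F : 'I_k -> digraph),
    (forall i, recursively_bridge_mirrored (F i)) /\
    isomorphic H (disjoint_union F).

(* Main.v *)
Require Import Defs.
From mathcomp Require Import all_boot all_order all_fingroup all_algebra.
From mathcomp Require Import zify ring.

(*HEADER*)

Set Implicit Arguments.
Unset Strict Implicit.
Unset Printing Implicit Defensive.

(** Encode a tournament by a skew-symmetric function [x] with values 1 and -1. Along an injective
    map [f], the product [ew] of [1 + x (f a) (f b)] over the edges of H is 2^e (e the number of
    edges) if [f] is an embedding and 0 otherwise, and it is affine in each entry of [x]. So if H is
    impartial, the sum over injections takes the same value at every skew [x], not only at
    tournaments ([sumi_const]). Pulling [x] back along all maps from n points to a finite set S
    turns this into [uniform]: over all maps from V to S, the weights sum to |S|^|V|
    ([impartial_uniform]). Inclusion-exclusion leads back to impartiality ([uniform_inj],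
    [uniform_impartial]).

    Uniformity passes to the parts of a disjoint union and back ([uniform_part], [uniform_sum]), and
    it does not change when an edge is deleted whose ends are exchanged by an automorphism of the
    remaining digraph ([uniform_flip]). By induction on the construction, recursively
    bridge-mirrored digraphs and their disjoint unions are uniform.

    Conversely, let H be connected and uniform with n vertices. The weights of all permutations then
    sum to n! for every skew [x] ([uniform_perm], later the hypothesis [J]), and everything follows
    from good choices of [x]. Signs of a linear order show that 2^e divides n!, so e < n; hence H is
    a tree and n is a power of 2 ([nedges_lt]). Signs between k blocks of size 2^j show that the
    tree splits into k connected parts of that size ([block_partition]), so some edge halves the
    tree ([balanced]) and siblings have subtrees of different sizes ([sibling]). An indeterminate on
    the tree edges yields a nontrivial automorphism of the undirected tree ([nonid_aut]), which,
    siblings being distinguishable, must flip the halving edge ([aut_flip]).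

    The delicate point is that the flip preserves the directions of the other edges ([mirror_inw]).
    A choice of [x] mixing both devices produces a vanishing sum whose terms are counted modulo 4
    and modulo a symmetry group; an edge whose mirror image has the wrong direction would give that
    count the wrong parity. Deleting the halving edge then leaves two isomorphic, connected, uniform
    halves, and induction applies ([uniform_connected_rbm]). *)

(** * Subtrees of a rooted tree given by its parent map, and rigidity of pruned trees *)

Section Descendants.
Variables (V : finType) (P : V -> V) (d : V -> nat) (r : V).
Hypothesis Pr : P r = r.
Hypothesis dP : forall x, x != r -> d (P x) < d x.

(** The subtree below [x], with [x] included; locked so that simplification does not expose
    [fconnect]. *)
Definition descendants (x : V) : {set V} := locked [set z | fconnect P z x].

Lemma mem_desc x z : (z \in descendants x) = fconnect P z x.
Proof. by rewrite /descendants -lock inE. Qed.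

Lemma desc_refl x : x \in descendants x. Proof. by rewrite mem_desc connect0. Qed.

Lemma up_ind (Q : V -> Prop) :
  Q r -> (forall x, x != r -> Q (P x) -> Q x) -> forall x, Q x.
Proof.
move=> Q0 QS x; have [n] := ubnP (d x); elim: n x => // n IH x dx.
by have [->|xr] := eqVneq x r; [|apply: QS => //; apply: IH; have := dP xr; lia].
Qed.

Lemma descE x z : (z \in descendants x) = (z == x) || ((z != r) && (P z \in descendants x)).
Proof.
rewrite !mem_desc; apply/idP/orP => [/iter_findex|[/eqP->|/andP[_ h]]].
- case: (findex P z x) => [/= ->|k]; first by left.
  rewrite iterSr => <-; have [->|_] := eqVneq z r.
    by left; rewrite Pr; elim: k => //= k /eqP <-; rewrite Pr.
  by right; rewrite fconnect_iter.
- exact: connect0.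
- exact: connect_trans (fconnect1 P z) h.
Qed.

Lemma desc_root z : z \in descendants r.
Proof. by elim/up_ind: z => [|z zr h]; rewrite ?desc_refl // descE zr h orbT. Qed.

Lemma root_desc x : (r \in descendants x) = (x == r).
Proof. by rewrite descE eqxx orbF eq_sym. Qed.

Lemma desc_trans x y z : z \in descendants y -> y \in descendants x -> z \in descendants x.
Proof. by rewrite !mem_desc; apply: connect_trans. Qed.

Lemma desc_parent x : x \in descendants (P x).
Proof. by rewrite mem_desc fconnect1. Qed.

Lemma desc_rank x z : z \in descendants x -> z != x -> d x < d z.
Proof.
elim/up_ind: z => [|z zr IH]; first by rewrite root_desc eq_sym => ->.
rewrite descE => /orP[->//|/andP[_ h]] _.
by have [<-|ne] := eqVneq (P z) x; [exact: dP|have := IH h ne; have := dP zr; lia].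
Qed.

Lemma desc_anti x z : z \in descendants x -> x \in descendants z -> z = x.
Proof.
move=> h1 h2; apply/eqP; apply: contraT => ne.
by have := desc_rank h1 ne; have := desc_rank h2; rewrite eq_sym ne => /(_ isT); lia.
Qed.

Lemma desc_linear x y z : z \in descendants x -> z \in descendants y -> (x \in descendants y) || (y \in descendants x).
Proof.
elim/up_ind: z => [|z zr IH].
  by rewrite root_desc => /eqP-> _; rewrite desc_root orbT.
rewrite descE => /orP[/eqP<- ->//|/andP[_ h1]].
rewrite descE => /orP[/eqP<-|/andP[_ h2]]; last exact: IH.
by apply/orP; right; apply: desc_trans h1; exact: desc_parent.
Qed.

Lemma desc_sub x z : z \in descendants x -> descendants z \subset descendants x.
Proof. by move=> h; apply/subsetP => y /desc_trans; apply. Qed.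

Lemma card_desc_lt x z : z \in descendants x -> z != x -> #|descendants z| < #|descendants x|.
Proof.
move=> h ne; apply/proper_card/properP; split; first exact: desc_sub.
exists x; first exact: desc_refl.
by apply: contra ne => /(desc_anti h)->.
Qed.

Lemma desc_eq_card x z : z \in descendants x -> #|descendants z| = #|descendants x| -> z = x.
Proof.
by move=> h e; apply/eqP; apply: contraT => /(card_desc_lt h); rewrite e ltnn.
Qed.

Lemma card_desc_gt0 x : 0 < #|descendants x|.
Proof. by apply/card_gt0P; exists x; apply: desc_refl. Qed.

Lemma desc_disjoint x y z :
  #|descendants x| = #|descendants y| -> x != y -> z \in descendants x -> z \notin descendants y.
Proof.
move=> e ne zx; apply/negP => zy.
case/orP: (desc_linear zx zy) => h; first by rewrite (desc_eq_card h e) eqxx in ne.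
by rewrite (desc_eq_card h (esym e)) eqxx in ne.
Qed.

Lemma child_above p z : z \in descendants p -> z != p -> exists c, [/\ P c = p, c != r, c != p & z \in descendants c].
Proof.
elim/up_ind: z => [|z zr IH]; first by rewrite root_desc eq_sym => ->.
rewrite descE => /orP[->//|/andP[_ h]] zp.
have [e|ne] := eqVneq (P z) p; first by exists z; split => //; apply: desc_refl.
have [c [h1 h2 h3 h4]] := IH h ne; exists c; split => //.
by apply: desc_trans h4; apply: desc_parent.
Qed.

(** Removing the edge above [y0] leaves two subtrees, and in each of them [f] is carried down from
    the top vertex. *)
Lemma cut1 (T : eqType) (f : V -> T) y0 :
  y0 != r ->
  (forall y, y != r -> y != y0 -> f y = f (P y)) ->
  forall z, f z = if z \in descendants y0 then f y0 else f r.
Proof.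
move=> y0r h; elim/up_ind => [|z zr IH]; first by rewrite root_desc (negbTE y0r).
rewrite descE zr /=; have [->//|ne] := eqVneq z y0.
by rewrite h.
Qed.

Lemma child_proper x : x != r -> x != P x.
Proof. by move=> xr; apply/eqP => e; have := dP xr; rewrite -e ltnn. Qed.

Lemma no_2cycle x : x != r -> P (P x) != x.
Proof.
move=> xr; have [e|Pxr] := eqVneq (P x) r; first by rewrite e Pr eq_sym.
by apply/eqP => e; have := ltn_trans (dP Pxr) (dP xr); rewrite e ltnn.
Qed.

Lemma parent_notin c : c != r -> P c \notin descendants c.
Proof.
move=> cr; apply/negP => h; have := child_proper cr.
by rewrite (desc_anti h (desc_parent c)) eqxx.
Qed.

Lemma child_desc_eq c x : x != r -> P x = P c -> c != r -> x \in descendants c -> x = c.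
Proof.
move=> xr e cr; rewrite descE xr e (negbTE (parent_notin cr)) orbF.
by move/eqP.
Qed.

Section Pruned.
Hypothesis sibling :
  forall x y, x != r -> y != r -> P x = P y -> #|descendants x| = #|descendants y| -> x = y.

(** A rooted tree whose siblings have subtrees of different sizes remembers where a branch of given
    size was cut off. Induction on the subtree at [p]: both prunings lie below the same child [c] of
    [p], and [alpha] or its square restricts to the pruned branch at [c]. *)
Lemma pruned_rigid (alpha : V -> V) p g g' :
  g \in descendants p -> g != p -> g' \in descendants p -> g' != p -> #|descendants g| = #|descendants g'| ->
  {in descendants p :\: descendants g &, injective alpha} ->
  alpha @: (descendants p :\: descendants g) = descendants p :\: descendants g' ->
  alpha p = p ->
  (forall z, z \in descendants p :\: descendants g -> z != p -> alpha (P z) = P (alpha z)) ->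
  g = g'.
Proof.
have [n] := ubnP #|descendants p|; elim: n p alpha => // n IH p al lt_n gp gnp g'p g'np es inj im alp com.
have pR : p \in descendants p :\: descendants g.
  by rewrite in_setD desc_refl andbT; apply: contra gnp => h; rewrite (desc_anti gp h).
have imR z : z \in descendants p :\: descendants g -> al z \in descendants p :\: descendants g'.
  by move=> h; rewrite -im imset_f.
have PRR c : c \in descendants p :\: descendants g -> c != p -> P c \in descendants p :\: descendants g.
  rewrite !in_setD => /andP[h1 h2] cp; apply/andP; split.
    by apply: contra h1; apply: desc_trans; apply: desc_parent.
  by move: h2; rewrite descE (negbTE cp) => /andP[].
(* [alpha] carries each child of [p] to a child of [p], and the remainder of its branch onto the
   remainder of the image branch. *)
have ch c : c \in descendants p :\: descendants g -> c != r -> P c = p ->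
    [/\ al c != r, P (al c) = p &
      al @: (descendants c :\: descendants g) = descendants (al c) :\: descendants g'].
  move=> cR cr Pc.
  have cp : c != p by rewrite -Pc child_proper.
  have Pac : P (al c) = p by rewrite -com // Pc.
  have acp : al c != p by rewrite -[X in _ != X]alp (inj_in_eq inj).
  have acr : al c != r by apply: contra acp => /eqP e; rewrite -Pac e Pr.
  split => //.
  have key z : z \in descendants p :\: descendants g -> (al z \in descendants (al c)) = (z \in descendants c).
    elim/up_ind: z => [|z zr IHz] zR.
      rewrite root_desc (negbTE cr).
      have <- : p = r by move: zR; rewrite in_setD !root_desc => /andP[_ /eqP ->].
      by rewrite alp; apply/negbTE; rewrite -[X in X \notin _]Pac parent_notin.
    have [->|zp] := eqVneq z p.
      rewrite alp -{2}Pc (negbTE (parent_notin cr)).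
      by apply/negbTE; rewrite -[X in X \notin _]Pac parent_notin.
    rewrite descE [RHS]descE zr /= -(IHz (PRR _ zR zp)) com // (inj_in_eq inj) //.
    have -> // : al z != r.
      apply: contra zp => /eqP e.
      have := imR _ zR; rewrite e in_setD !root_desc => /andP[_ /eqP pr].
      by apply/eqP/inj => //; rewrite e alp pr.
  have subR z : z \in descendants c -> z \in descendants p.
    by move/desc_trans; apply; rewrite -Pc desc_parent.
  apply/setP => w; apply/imsetP/idP => [[z]|].
    rewrite in_setD => /andP[h1 h2] ->.
    have zR : z \in descendants p :\: descendants g by rewrite in_setD h1 subR.
    by rewrite in_setD key // h2 andbT; have := imR _ zR; rewrite in_setD => /andP[].
  rewrite in_setD => /andP[h1 h2].
  have : w \in al @: (descendants p :\: descendants g).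
    rewrite im in_setD h1 /=; apply: desc_trans h2 _.
    by rewrite -[X in descendants X]Pac; exact: desc_parent.
  case/imsetP => z zR e; exists z => //.
  by rewrite in_setD -key // -e h2 andbT; move: zR; rewrite in_setD => /andP[].
have [c [Pc cr cp gc]] := child_above gp gnp.
have [c' [Pc' c'r c'p g'c']] := child_above g'p g'np.
have indesc x : P x = p -> x \in descendants p by move=> <-; exact: desc_parent.
(* Pruning inside one child of [p] leaves the branches of the other children intact. *)
have cdist b k x : k != r -> P k = p -> b \in descendants k -> x != r -> P x = p -> x != k ->
    (x \notin descendants b) /\ descendants x :\: descendants b = descendants x.
  move=> kr Pk bk xr Px ne.
  have xk : x \notin descendants k by apply: contra ne => h; rewrite (child_desc_eq xr _ kr h) // Px.
  have kx : k \notin descendants x by apply: contra ne => h; rewrite (child_desc_eq kr _ xr h) // Px.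
  split; first by apply: contra xk => h; apply: desc_trans bk.
  apply/setP => z; rewrite in_setD; apply/andP/idP => [[]//|zx]; split => //.
  apply/negP => zb; have zk := desc_trans zb bk.
  by case/orP: (desc_linear zx zk) => h; [rewrite h in xk|rewrite h in kx].
have szD b k : b \in descendants k -> #|descendants k :\: descendants b| = #|descendants k| - #|descendants b|.
  by move=> h; rewrite cardsD (setIidPr (desc_sub h)).
have cardim x : x != r -> x \in descendants p :\: descendants g -> P x = p ->
   #|descendants (al x) :\: descendants g'| = #|descendants x :\: descendants g|.
  move=> xr xR Px; have [_ _ <-] := ch x xR xr Px; rewrite card_in_imset //.
  move=> a b; rewrite !in_setD => /andP[a1 a2] /andP[b1 b2]; apply: inj; rewrite in_setD.
    by rewrite a1 (desc_trans a2 (indesc _ Px)).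
  by rewrite b1 (desc_trans b2 (indesc _ Px)).
have sg := card_desc_gt0 g.
(* Otherwise the branch at [c'] is intact in the source. Its image is either the branch at [c']
   pruned by [g'], which is too small, or another intact branch of equal size, which [sibling]
   forbids. *)
have ec : c' = c.
  apply/eqP; apply: contraT => ne.
  have [c'g c'D] := cdist g c c' cr Pc gc c'r Pc' ne.
  have c'R : c' \in descendants p :\: descendants g by rewrite in_setD c'g indesc.
  have [ar Pa _] := ch c' c'R c'r Pc'; have := cardim _ c'r c'R Pc'; rewrite c'D.
  have [->|ne2] := eqVneq (al c') c'.
    rewrite szD // -es => h; move: sg (card_desc_gt0 c') h.
    by move: #|descendants g| #|descendants c'| => a b; clear; lia.
  have [_ ->] := cdist g' c' (al c') c'r Pc' g'c' ar Pa ne2.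
  by move=> h; rewrite (sibling ar c'r _ h) ?Pa ?Pc' ?eqxx in ne2.
rewrite {c' Pc' c'r c'p}ec in g'c'.
have [egc|gnc] := eqVneq g c.
  by subst g; rewrite (desc_eq_card g'c').
have [egc|g'nc] := eqVneq g' c.
  by subst g'; rewrite (desc_eq_card gc).
have cR : c \in descendants p :\: descendants g.
  by rewrite in_setD indesc // andbT; apply: contra gnc => h; rewrite (desc_anti gc h).
have sub : {subset descendants c :\: descendants g <= descendants p :\: descendants g}.
  by move=> z; rewrite !in_setD => /andP[-> h]; rewrite (desc_trans h) ?indesc.
have lt_c : #|descendants c| < n.
  exact: leq_trans (card_desc_lt (indesc _ Pc) cp) _.
have [ar Pa imc] := ch c cR cr Pc.
have [eac|ac] := eqVneq (al c) c.
  apply: (IH c al) => //; first by move=> a b /sub ha /sub hb; apply: inj.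
    by rewrite imc eac.
  move=> z zR zc; apply: com; first exact: sub.
  apply: contraTneq zR => ->; rewrite in_setD -{2}Pc (negbTE (parent_notin cr)).
  by rewrite andbF.
(* [alpha] may exchange the pruned branch with a full sibling of the same size;
   then its square fixes the pruned branch. *)
set k := al c in ar Pa imc ac.
have [kg kD] := cdist g c k cr Pc gc ar Pa ac.
have [_ kD'] := cdist g' c k cr Pc g'c' ar Pa ac.
have kR : k \in descendants p :\: descendants g by rewrite in_setD kg indesc.
have [akr Pak imk] := ch k kR ar Pa.
have akk : al k = c.
  apply/eqP; apply: contraT => ne.
  have [_ D2] := cdist g' c (al k) cr Pc g'c' akr Pak ne.
  have := cardim _ ar kR Pa; rewrite D2 kD => h.
  have /inj : al k = al c by apply: sibling => //; rewrite Pak -/k Pa.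
  by move=> /(_ kR cR) /eqP; rewrite (negbTE ac).
have subk : {subset descendants k <= descendants p :\: descendants g}.
  move=> z zk; rewrite in_setD (desc_trans zk (indesc _ Pa)) andbT.
  by move: zk; rewrite -kD in_setD => /andP[].
have alk z : z \in descendants c :\: descendants g -> al z \in descendants k.
  by move=> h; rewrite -kD' -imc imset_f.
apply: (IH c (al \o al)) => //=.
- move=> a b ha hb /= e; apply: (inj); [exact: sub|exact: sub|].
  by apply: inj => //; apply: subk; apply: alk.
- by rewrite imset_comp imc kD' -kD imk akk.
- move=> z zR zc; rewrite com ?sub //.
    rewrite com //; first by apply: subk; apply: alk.
    apply: contraTneq (alk _ zR) => ->; rewrite -{1}Pa parent_notin //.
  apply: contraTneq zR => ->; rewrite in_setD -{2}Pc (negbTE (parent_notin cr)).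
  by rewrite andbF.
Qed.
End Pruned.
End Descendants.

(** * 2-adic valuations of factorials and binomial coefficients *)

Lemma logn2_fact_double m : logn 2 (m.*2)`! = m + logn 2 m`!.
Proof.
elim: m => // m IH; rewrite doubleS !factS -mul2n.
rewrite -[(2 * m).+2]/((2 * m).+1.+1) (_ : (2 * m).+2 = 2 * m.+1); last by lia.
rewrite !lognM ?muln_gt0 ?fact_gt0 //= (@logn_prime 2 2) // eqxx.
have -> : logn 2 (2 * m).+1 = 0 by rewrite logn_coprime // coprime2n; lia.
by rewrite mul2n IH; lia.
Qed.

(** By Legendre the valuation is n minus the number of binary digits 1 of n; the halving recursion
    suffices here. *)
Lemma logn2_fact n : 0 < n -> logn 2 n`! < n /\ (logn 2 n`! = n.-1 -> exists j, n = 2 ^ j).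
Proof.
elim/ltn_ind: n => n IH n0.
have [e|o] := boolP (odd n); last first.
  have [m em] : exists m, n = m.*2 by exists n./2; lia.
  subst n; have m0 : 0 < m by lia.
  have [h1 h2] := IH m ltac:(lia) m0; rewrite logn2_fact_double; split; first lia.
  move=> h3; have [|j ej] := h2; first lia.
  by exists j.+1; rewrite expnS -ej; lia.
have [m em] : exists m, n = m.*2.+1 by exists n./2; lia.
subst n; rewrite factS lognM ?fact_gt0 // logn2_fact_double.
have -> : logn 2 m.*2.+1 = 0 by rewrite logn_coprime // coprime2n.
case: m IH {n0 e} => [|m] IH; first by split => // _; exists 0.
by have [h1 _] := IH m.+1 ltac:(lia) isT; split; lia.
Qed.

Lemma logn2_fact_pow j : logn 2 (2 ^ j)`! = (2 ^ j).-1.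
Proof.
elim: j => // j IH; rewrite expnS mul2n logn2_fact_double IH.
by have := expn_gt0 2 j; lia.
Qed.

(** A valuation below 2 forces [s!] and [(2 ^ k - s)!] to have maximal valuation, so [s] and
    [2 ^ k - s] are powers of 2; as they add up to a power of 2 they are equal. *)
Lemma four_dvd_bin k s : 0 < s -> s < 2 ^ k -> s.*2 != 2 ^ k -> 4 %| 'C(2 ^ k, s).
Proof.
move=> s0 sk ne; have sk' := ltnW sk.
have := bin_fact sk'; move/(congr1 (logn 2)).
rewrite !lognM ?muln_gt0 ?fact_gt0 ?bin_gt0 // logn2_fact_pow => e.
have [h1 h2] := logn2_fact s0.
have [|h3 h4] := @logn2_fact (2 ^ k - s); first by lia.
have C0 : 0 < 'C(2 ^ k, s) by rewrite bin_gt0.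
rewrite -[4]/(2 ^ 2) pfactor_dvdn //; rewrite leqNgt; apply/negP => C2.
have [i ei] : exists i, s = 2 ^ i by apply: h2; lia.
have [j ej] : exists j, 2 ^ k - s = 2 ^ j by apply: h4; lia.
have ek : 2 ^ k = 2 ^ i + 2 ^ j by lia.
have [eij|[lt|lt]] : i = j \/ (i < j \/ j < i) by lia.
- by move: ne; rewrite ek ei eij addnn eqxx.
- have ik : i < k by rewrite -(@ltn_exp2l 2) // -ei.
  have : 2 ^ i.+1 %| 2 ^ k - 2 ^ j by rewrite dvdn_sub // dvdn_exp2l.
  by rewrite ek addnK dvdn_Pexp2l // ltnn.
- have jk : j < k by rewrite -(@ltn_exp2l 2) // -ej; lia.
  have : 2 ^ j.+1 %| 2 ^ k - 2 ^ i by rewrite dvdn_sub // dvdn_exp2l.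
  by rewrite ek addnC addnK dvdn_Pexp2l // ltnn.
Qed.


Import GRing.Theory Num.Theory Order.TTheory.
Local Open Scope ring_scope.

(** * Divisibility of sums invariant under a group *)

Lemma dvdz_sum (I : finType) (A : pred I) (F : I -> int) (m : int) :
  (forall i, A i -> (m %| F i)%Z) -> (m %| \sum_(i | A i) F i)%Z.
Proof. by move=> h; apply: (big_ind (fun x => (m %| x)%Z)) => // x y; exact: rpredD. Qed.

(** Each coset of [G] meeting [A] contributes [#|G|] equal terms, each a multiple of [m]. *)
Lemma orbit_sum_dvd (gT : finGroupType) (G : {group gT}) (A : pred gT) (w : gT -> int) (m : int) :
  (forall t g, g \in G -> A (t * g)%g = A t) ->
  (forall t g, g \in G -> w (t * g)%g = w t) ->
  (forall t, A t -> (m %| w t)%Z) ->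
  ((m * #|G|%:R)%R %| (\sum_(t | A t) w t)%R)%Z.
Proof.
move=> hA hw hm.
rewrite (partition_big (fun t : gT => (t *: G)%g) xpredT) //=.
apply: dvdz_sum => C _.
have [t0 /andP[At0 /eqP eC]|no] := pickP (fun t => A t && ((t *: G)%g == C)); last first.
  by rewrite big_pred0 ?dvdz0.
subst C; rewrite (eq_bigr (fun _ => w t0)); last first.
  move=> t /andP[_ /eqP e]; have : t \in (t0 *: G)%g by rewrite -e lcoset_refl.
  by case/lcosetP => g gG ->; rewrite hw.
rewrite (eq_bigl [in (t0 *: G)%g]); last first.
  move=> t; rewrite -topredE /=; apply/andP/idP => [[_ /eqP <-]|]; first exact: lcoset_refl.
  case/lcosetP => g gG ->; rewrite hA // At0; split => //.
  by rewrite lcosetM lcoset_id.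
rewrite sumr_const card_lcoset -[w t0 *+ _]mulr_natr.
exact: (dvdz_mul (hm _ At0) (dvdzz _)).
Qed.

Definition skew (R : zmodType) (I : Type) (x : I -> I -> R) := forall a b, x a b = - x b a.

Lemma eq_card_bij (A B : finType) : #|A| = #|B| -> exists h : A -> B, bijective h.
Proof.
move=> e; exists (fun a => enum_val (cast_ord e (enum_rank a))).
exists (fun b => enum_val (cast_ord (esym e) (enum_rank b))) => z;
  by rewrite enum_valK ?cast_ordK ?cast_ordKV enum_rankK.
Qed.

(** * Block weights and splittings of the tree into connected parts of equal size *)

Section Rooted.
Variables (V : finType) (P : V -> V) (d : V -> nat) (r : V).
Hypothesis Pr : P r = r.
Hypothesis dP : forall x, x != r -> (d (P x) < d x)%N.
Variable inw : pred V.

Local Notation desc := (descendants P).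

(** A tree edge is named by its lower end, here and throughout. *)
Definition cross (T : eqType) (f : V -> T) : {set V} := [set y | (y != r) && (f y != f (P y))].

(** Climb from [z] while [f] keeps its value: the climb stops at the root or below an edge where [f]
    changes. *)
Lemma class_top (T : eqType) (f : V -> T) z :
  exists t, [/\ t \in r |: cross f, f t = f z, z \in desc t &
                forall w, z \in desc w -> w \in desc t -> f w = f z].
Proof.
elim/(up_ind dP): z => [|z zr [t [h1 h2 h3 h4]]].
  exists r; split; rewrite ?setU11 ?desc_refl // => w.
  by rewrite (root_desc Pr) => /eqP->.
have [e|ne] := eqVneq (f z) (f (P z)); last first.
  exists z; split; rewrite ?desc_refl //; first by rewrite !inE zr ne orbT.
  by move=> w a b; rewrite (desc_anti Pr dP a b).
exists t; rewrite e; split => //; first by apply: desc_trans h3; apply: desc_parent.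
move=> w; rewrite (descE Pr) zr /= => /orP[/eqP<- //|]; exact: h4.
Qed.

Lemma card_classes (T : finType) (f : V -> T) : (#|f @: V| <= #|cross f|.+1)%N.
Proof.
apply: leq_trans (_ : #|f @: (r |: cross f)| <= _)%N.
  apply/subset_leq_card/subsetP => _ /imsetP[z _ ->].
  by have [t [h1 <- _ _]] := class_top f z; apply: imset_f.
apply: leq_trans (leq_imset_card _ _) _.
by rewrite cardsU1; case: (_ \notin _).
Qed.

(** If [card_classes] is an equality, each class has a single top, that is, the classes of [f] are
    connected. *)
Lemma top_inj (T : finType) (f : V -> T) : (#|cross f| < #|f @: V|)%N ->
  {in r |: cross f &, injective f}.
Proof.
move=> h; apply/imset_injP; rewrite eqn_leq leq_imset_card /=.
apply: leq_trans (_ : #|f @: V| <= _)%N; last first.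
  apply/subset_leq_card/subsetP => _ /imsetP[z _ ->].
  by have [t [h1 <- _ _]] := class_top f z; apply: imset_f.
by apply: leq_trans h; rewrite cardsU1; case: (_ \notin _).
Qed.

(** [inw y] means that the edge above [y] points to the parent. With this sign, a skew function can
    always be evaluated from child to parent. *)
Definition edge_sign (y : V) : int := if inw y then 1 else -1.
Definition tree_weight (x : V -> V -> int) (t : {perm V}) : int :=
  \prod_(y | y != r) (1 + edge_sign y * x (t y) (t (P y))).

(** The sign of a comparison of [b] values, 0 on ties: an ordering between blocks, neutral inside
    each block. *)
Definition block (b : V -> nat) (a c : V) : int := (b a < b c)%N%:R - (b c < b a)%N%:R.

Lemma block_skew b : skew (block b).
Proof. by move=> x y; rewrite /block opprB. Qed.

(** Each edge between different blocks contributes a factor 0 or 2. *)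
Lemma tree_weight_block b t : (2 ^+ #|cross (b \o t)| %| tree_weight (block b) t)%Z.
Proof.
rewrite /tree_weight (bigID [in cross (b \o t)]) /= dvdz_mulr //.
rewrite (eq_bigl [in cross (b \o t)]); last by move=> y; rewrite inE; case: (y != r).
rewrite -prodr_const; apply: (big_ind2 (fun u v => (u %| v)%Z)) => //.
  by move=> u1 u2 v1 v2; exact: dvdz_mul.
move=> y; rewrite inE /= /block /edge_sign => /andP[_ ne].
by case: (inw y); move: ne; case: ltngtP; rewrite //= ?dvdz0.
Qed.

Hypothesis J : forall x, skew x -> \sum_(t : {perm V}) tree_weight x t = (#|V|`!)%:R.

(** If every placement of the k blocks cut at least k edges, each weight would be divisible by 2^k.
    Permuting labels inside the blocks preserves weights, so 2^k (q!)^k with q = 2^j would divide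
    n!, against the 2-adic valuations n and n - 1. *)
Lemma block_partition k j : #|V| = (k * 2 ^ j)%N -> (exists i, #|V| = 2 ^ i)%N -> (0 < k)%N ->
  exists f : V -> 'I_k, (forall i, #|[set z | f z == i]| = 2 ^ j)%N /\ (#|cross f| < k)%N.
Proof.
set q := (2 ^ j)%N => eV [i0 en] k0.
have [|h [h' hK h'K]] := @eq_card_bij V ('I_k * 'I_q)%type; first by rewrite card_prod !card_ord.
pose b z : 'I_k := (h z).1.
have fib i (t : {perm V}) : #|[set z | b (t z) == i]| = q.
  rewrite -[RHS](card_ord q) -cardsT -(@card_imset _ _ (fun a => (t^-1)%g (h' (i, a)))); last first.
    by move=> a a' /perm_inj /(can_inj h'K) [].
  apply: eq_card => z; rewrite inE; apply/eqP/imsetP => [<-|[a _ ->]].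
    by exists (h (t z)).2; rewrite ?inE // -surjective_pairing hK permK.
  by rewrite permKV /b h'K.
have [/existsP[t ht]|no] := boolP [exists t : {perm V}, #|cross (b \o t)| < k]%N.
  by exists (b \o t); split => // i; apply: fib.
exfalso.
(* The label permutations preserving each block; they form a group of order (q!)^k. *)
pose gam (g : {ffun 'I_k -> {perm 'I_q}}) z := h' ((h z).1, g (h z).1 (h z).2).
have gam_inj g : injective (gam g).
  move=> z z' /(can_inj h'K) [e]; rewrite e => /perm_inj e2.
  by apply: (can_inj hK); rewrite [LHS]surjective_pairing [RHS]surjective_pairing e e2.
pose G := [set perm (gam_inj g) | g in setT].
have gG : group_set G.
  apply/group_setP; split.
    apply/imsetP; exists [ffun=> 1%g] => //; apply/permP => z.
    by rewrite perm1 permE /gam ffunE perm1 -surjective_pairing hK.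
  move=> _ _ /imsetP[g _ ->] /imsetP[g' _ ->]; apply/imsetP.
  exists [ffun i => g i * g' i]%g => //; apply/permP => z.
  by rewrite permM !permE /gam h'K /= ffunE permM.
have cG : #|G| = (q`! ^ k)%N.
  rewrite card_imset; last first.
    move=> g g' e; apply/ffunP => i; apply/permP => a.
    have := congr1 (fun s : {perm V} => s (h' (i, a))) e.
    by rewrite !permE /gam h'K /= => /(can_inj h'K) [].
  rewrite cardsT card_ffun card_ord; congr (_ ^ _)%N.
  have := card_perm [set: 'I_q]; rewrite cardsT card_ord => <-.
  by rewrite -cardsT; apply: eq_card => s; rewrite !inE; symmetry; apply/subsetP => x.
pose bb z : nat := b z.
have bG z s : s \in G -> bb (s z) = bb z.
  by case/imsetP => g _ ->; rewrite permE /bb /b /gam h'K.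
have : (((2 : int) ^+ k * #|G|%:R)%R %| ((#|V|`!)%:R)%R)%Z.
  rewrite -(J (block_skew bb)).
  apply: (@orbit_sum_dvd _ (Group gG) xpredT) => // [t s sG|t _].
    by apply: eq_bigr => y _; rewrite !permM /block !(bG _ _ sG).
  apply: dvdz_trans (tree_weight_block bb t).
  apply: dvdz_exp2l; rewrite leqNgt; apply: contra no => lt; apply/existsP; exists t.
  by apply: leq_trans lt; apply: subset_leq_card; apply/subsetP => y; rewrite !inE.
(* The left side has valuation k + k(q - 1) = kq = n, the right side n - 1 because n is a power of
   2. *)
rewrite cG dvdzE abszM !natz abszX /= => /(dvdn_leq_log 2 (fact_gt0 _)).
rewrite lognM ?expn_gt0 ?fact_gt0 // lognX lognX (@logn_prime 2 2) // en logn2_fact_pow.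
rewrite logn2_fact_pow -en eV -/q.
have := expn_gt0 2 j; rewrite -/q; nia.
Qed.

End Rooted.

(** * Sizes of sibling subtrees and the halving edge *)

Lemma dvdn_card_fibres (V T : finType) (f : V -> T) (U : {set V}) q :
  (forall i, #|[set z | f z == i]| = q) ->
  (forall z z', z \in U -> f z = f z' -> z' \in U) -> (q %| #|U|)%N.
Proof.
move=> fib clos; rewrite -sum1_card (partition_big f xpredT) //=.
apply: (big_ind (fun a => (q %| a)%N)) => // [a b|i _]; first exact: dvdn_add.
have [z /andP[zU /eqP fz]|no] := pickP (fun z => (z \in U) && (f z == i)); last first.
  by rewrite big_pred0.
rewrite sum1_card -(fib i) (_ : #|_| = #|[set z | f z == i]|) //.
apply: eq_card => z'; rewrite -topredE /= inE; apply/andP/idP => [[]//|/eqP e].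
by split; [apply: clos zU _; rewrite fz e|rewrite e].
Qed.

Section Rooted.
Variables (V : finType) (P : V -> V) (d : V -> nat) (r : V).
Hypothesis Pr : P r = r.
Hypothesis dP : forall x, x != r -> (d (P x) < d x)%N.
Variable inw : pred V.
Local Notation desc := (descendants P).
Local Notation pw := (tree_weight P r inw).
Hypothesis J : forall x, skew x -> \sum_(t : {perm V}) pw x t = (#|V|`!)%:R.
Variable i0 : nat.
Hypothesis cardV : #|V| = (2 ^ i0)%N.

(** Let 2^v be the exact power of 2 in the common size. Split the tree into connected parts of size
    2^(v+1). The part containing the common parent would have to contain at least 2^v vertices below
    each of [x] and [y], and the parent as well, which is one vertex too many. *)
Lemma sibling x y : x != r -> y != r -> P x = P y -> #|desc x| = #|desc y| -> x = y.
Proof.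
move=> xr yr Pxy exy.
set a := #|desc x| in exy.
have a0 : (0 < a)%N by apply: card_desc_gt0.
have an : (a < 2 ^ i0)%N.
  rewrite -cardV -cardsT; apply/proper_card/properP; split; first exact: subsetT.
  by exists r; rewrite ?inE // (root_desc Pr).
pose v := logn 2 a.
have va : (2 ^ v %| a)%N by rewrite pfactor_dvdn.
have vi : (v < i0)%N.
  by rewrite -(@ltn_exp2l 2) //; apply: leq_ltn_trans an; apply: dvdn_leq.
have [|||f [fib cr]] := block_partition J (k := 2 ^ (i0 - v.+1)) (j := v.+1).
- by rewrite -expnD subnK.
- by exists i0.
- by rewrite expn_gt0.
set q := (2 ^ v.+1)%N in fib.
have im : #|f @: V| = (2 ^ (i0 - v.+1))%N.
  rewrite -[RHS]card_ord -cardsT; apply: eq_card => i; rewrite [in RHS]inE.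
  have /card_gt0P[z] : (0 < #|[set z | f z == i]|)%N by rewrite fib expn_gt0.
  by rewrite inE => /eqP <-; apply: imset_f.
have tinj := top_inj Pr dP (f := f).
rewrite im in tinj; have {}tinj := tinj cr.
pose p := P x; pose Z := [set z | f z == f p].
(* The vertices below [w] outside [Z] fill whole parts, so their number is a multiple of 2^(v+1). As
   the size of the subtree is not, its intersection with [Z] is a nonzero multiple of 2^v. *)
have half w : w != r -> P w = p -> #|desc w| = a -> (2 ^ v <= #|desc w :&: Z|)%N.
  move=> wr Pw ew.
  have dq : (q %| #|desc w :\: Z|)%N.
    apply: dvdn_card_fibres fib _ => z z'; rewrite !inE => /andP[zZ].
    move=> zw e; rewrite -e zZ /=.
    have [t [t1 t2 t3 t4]] := class_top Pr dP f z.
    have [t' [t'1 t'2 t'3 _]] := class_top Pr dP f z'.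
    have ett : t = t' by apply: tinj => //; rewrite t2 t'2.
    subst t'.
    have [wt|nwt] := boolP (t \in desc w); first by apply: desc_trans wt.
    have := desc_linear Pr dP zw t3; rewrite (negbTE nwt) orbF.
    rewrite (descE Pr) => /orP[/eqP ewt|/andP[_]]; first by rewrite ewt desc_refl in nwt.
    rewrite Pw => pt; case/negP: zZ; rewrite eq_sym; apply/eqP/t4 => //.
    by apply: desc_trans zw _; rewrite -Pw; apply: desc_parent.
  have := cardsID Z (desc w); rewrite ew => e.
  have dv : (2 ^ v %| #|desc w :&: Z|)%N.
    rewrite -(dvdn_addl (n := #|desc w :\: Z|)) ?e //.
    by apply: dvdn_trans dq; apply: dvdn_exp2l.
  have [z0|] := posnP #|desc w :&: Z|; last by move/dvdn_leq => /(_ _ dv).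
  have : (q %| a)%N by rewrite -e z0 add0n.
  by rewrite pfactor_dvdn // ltnn.
have hx := half x xr erefl erefl.
have hy := half y yr (esym Pxy) (esym exy).
apply/eqP; apply: contraT => ne.
have : (#|p |: ((desc x :&: Z) :|: (desc y :&: Z))| <= #|Z|)%N.
  apply/subset_leq_card/subsetP => z; rewrite !inE => /orP[/eqP->//|/orP[]/andP[]//].
rewrite fib cardsU1 cardsU.
have -> : (desc x :&: Z) :&: (desc y :&: Z) = set0.
  apply/setP => z; rewrite in_set0 !in_setI; apply/negP => /andP[/andP[h1 _] /andP[h2 _]].
  by rewrite (negbTE (desc_disjoint Pr dP exy ne h1)) in h2.
have -> : p \notin desc x :&: Z :|: desc y :&: Z.
  have h1 := parent_notin Pr dP xr; rewrite -/p in h1.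
  have h2 : p \notin desc y by rewrite /p Pxy (parent_notin Pr dP).
  by rewrite in_setU !in_setI (negbTE h1) (negbTE h2).
rewrite cards0 subn0 /q expnS; move: hx hy; clear.
by move: #|_| #|_| (2 ^ v)%N => A B C; lia.
Qed.

(** Two blocks of half size can be placed so that a single edge is cut. *)
Lemma balanced : (0 < i0)%N -> exists2 v, v != r & (#|desc v|.*2 = #|V|)%N.
Proof.
case: i0 cardV => // i cV _.
have [|||f [fib cr]] := block_partition J (k := 2) (j := i).
- by rewrite cV expnS.
- by exists i.+1.
- by [].
have im : #|f @: V| = 2.
  rewrite -[RHS]card_ord -cardsT; apply: eq_card => k; rewrite [in RHS]inE.
  have /card_gt0P[z] : (0 < #|[set z | f z == k]|)%N by rewrite fib expn_gt0.
  by rewrite inE => /eqP <-; apply: imset_f.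
have e1 : #|cross P r f| = 1%N.
  have h := card_classes Pr dP f; rewrite im ltnS in h.
  by apply/eqP; rewrite eqn_leq h andbT -ltnS.
have /cards1P[v ev] : #|cross P r f| == 1%N by rewrite e1.
have /[!inE]/andP[vr fv] : v \in cross P r f by rewrite ev set11.
exists v => //; rewrite cV expnS -(fib (f v)) mul2n; congr _.*2.
have c1 := cut1 Pr dP (f := f) vr.
have {}c1 z : f z = if z \in desc v then f v else f r.
  apply: c1 => y yr yv; apply/eqP; apply: contraT => ne.
  have : y \in cross P r f by rewrite inE yr.
  by rewrite ev inE (negbTE yv).
have frv : f r != f v.
  apply: contra fv => /eqP e; rewrite eq_sym c1.
  by rewrite (negbTE (parent_notin Pr dP vr)) e.
apply: eq_card => z; rewrite [RHS]inE c1.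
by case: ifP => // _; [rewrite eqxx|rewrite (negbTE frv)].
Qed.

End Rooted.

(** * Parity of the number of inward subtrees of a given size *)

Lemma perm_moving (T : finType) (A B : {set T}) : #|A| = #|B| ->
  exists s : {perm T}, (forall z, (s z \in B) = (z \in A)) /\
                       (forall z, z \notin A :|: B -> s z = z).
Proof.
have [n] := ubnP #|A :\: B|; elim: n A => // n IH A lt e.
have eD : #|A :\: B| = #|B :\: A|.
  by apply/eqP; rewrite -(eqn_add2l #|A :&: B|) cardsID setIC cardsID e.
have [z0|/card_gt0P[x xAB]] := posnP #|A :\: B|.
  exists 1%g; split=> z; rewrite perm1 //.
  move: z0 eD => /eqP; rewrite cards_eq0 setD_eq0 => sAB.
  by move/eqP: e; rewrite eqn_leq => /andP[_ le]; rewrite (eqP (_ : A == B)) // eqEcard sAB.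
have /card_gt0P[y yBA] : (0 < #|B :\: A|)%N by rewrite -eD; apply/card_gt0P; exists x.
move: xAB yBA; rewrite !inE => /andP[xB xA] /andP[yA yB].
have ne : x != y by apply: contraNneq xB => ->.
have [||s [s1 s2]] := IH (y |: A :\ x).
- rewrite (_ : _ :\: B = (A :\: B) :\ x); last first.
    apply/setP => z; rewrite !inE; have [->|_] := eqVneq z y; first by rewrite yB !andbF.
    by rewrite /= andbCA.
  by apply: leq_trans (_ : (#|A :\: B| <= n)%N) => //; rewrite [X in (_ < X)%N](cardsD1 x) !inE xA xB.
- by rewrite cardsU1 !inE (negbTE yA) andbF -e [RHS](cardsD1 x) xA.
exists (tperm x y * s)%g; split => z; rewrite permM.
  rewrite s1 !inE; case: tpermP => [->|->|/eqP zx /eqP zy].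
  - by rewrite eqxx xA.
  - by rewrite (negbTE ne) eqxx (negbTE yA).
  - by rewrite zx (negbTE zy).
rewrite inE negb_or => /andP[zA zB].
rewrite tpermD; first last.
- by apply: contraNneq zB => <-.
- by apply: contraNneq zA => <-.
apply: s2; rewrite !inE (negbTE zA) (negbTE zB) andbF !orbF.
by apply: contraNneq zB => ->.
Qed.

Section Rooted.
Variables (V : finType) (P : V -> V) (d : V -> nat) (r : V).
Hypothesis Pr : P r = r.
Hypothesis dP : forall x, x != r -> (d (P x) < d x)%N.
Variable inw : pred V.
Local Notation desc := (descendants P).
Local Notation pw := (tree_weight P r inw).
Hypothesis J : forall x, skew x -> \sum_(t : {perm V}) pw x t = (#|V|`!)%:R.
Variable i0 : nat.
Hypothesis cardV : #|V| = (2 ^ i0)%N.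
Hypothesis half : forall y, y != r -> (#|desc y|.*2 <= #|V|)%N.

Lemma desc_set_inj : injective desc.
Proof.
move=> x y e; apply: (desc_anti Pr dP); first by rewrite -e desc_refl.
by rewrite e desc_refl.
Qed.

(** Every set of size [s] is the preimage of [A] under the same number of permutations. The identity
    is cleared of denominators to stay in the integers. *)
Lemma sum_subsets s (F : {set V} -> int) (A : {set V}) : #|A| = s ->
  (\sum_(t : {perm V}) F (t @^-1: A)) * 'C(#|V|, s)%:R = (#|V|`!)%:R * \sum_(S : {set V} | #|S| == s) F S.
Proof.
move=> cA.
have [c hc] : exists c, forall S : {set V}, #|S| = s -> #|[set t : {perm V} | t @^-1: A == S]| = c.
  exists #|[set t : {perm V} | t @^-1: A == A]| => S cS.
  have [k [k1 _]] := @perm_moving _ S A (etrans cS (esym cA)).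
  rewrite -[RHS](card_imset _ (mulgI k)); apply: eq_card => t.
  rewrite [LHS]inE; apply/eqP/imsetP => [e|[t' + ->]].
    exists (k^-1 * t)%g; last by rewrite mulKVg.
    rewrite inE; apply/eqP/setP => z; rewrite inE permM.
    have := congr1 (fun B : {set V} => (k^-1)%g z \in B) e.
    by rewrite /= inE => ->; rewrite -k1 permKV.
  rewrite inE => /eqP e; apply/setP => z; rewrite inE permM -k1 -[in RHS]e inE.
  by [].
have key G : \sum_(t : {perm V}) G (t @^-1: A) = c%:R * \sum_(S : {set V} | #|S| == s) G S :> int.
  rewrite (partition_big (fun t : {perm V} => t @^-1: A) (fun S => #|S| == s)) /=; last first.
    move=> t _; rewrite -cA; apply/eqP; rewrite -(card_imset _ (@perm_inj _ t)).
    apply: eq_card => z; apply/imsetP/idP => [[y + ->]|zA]; first by rewrite inE.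
    by exists (t^-1 z)%g; rewrite ?inE permKV.
  rewrite mulr_sumr; apply: eq_bigr => S /eqP cS.
  rewrite (eq_bigr (fun _ => G S)); last by move=> t /eqP ->.
  rewrite -(hc S cS) sumr_const -[G S *+ _]mulr_natl; congr (_%:R * _).
  by apply: eq_card => t; rewrite -topredE /= inE.
have e1 := key (fun _ => 1).
rewrite !sumr_const in e1.
have e2 : (#|V|`!)%:R = c%:R * ('C(#|V|, s))%:R :> int.
  rewrite -(card_draws V s).
  have := card_perm [set: V]; rewrite cardsT => <-.
  rewrite (_ : #|perm_on _| = #|[pred t : {perm V} | true]|); last first.
    by apply: eq_card => t; rewrite !inE; apply/subsetP.
  rewrite e1; congr (_ * _%:R).
  by apply: eq_card => S; rewrite !inE.
by rewrite key e2 -!mulrA; congr (_ * _); rewrite mulrC.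
Qed.

(** Order the sets of size [s] before their complements. The weights of these sets sum to a binomial
    coefficient divisible by 4. The subtree of an inward [x] has weight 2 and every other set has
    weight divisible by 4, so twice the number of such [x] vanishes modulo 4. *)
Lemma even_inward s : (0 < s)%N -> (s.*2 < #|V|)%N ->
  ~~ odd #|[set x | [&& x != r, inw x & #|desc x| == s]]|.
Proof.
move=> s0 sV; set X := [set x | _].
have [A cA] : exists A : {set V}, #|A| = s.
  have /card_gt0P[A] : (0 < #|[set A : {set V} | #|A| == s]|)%N.
    by rewrite card_draws bin_gt0; lia.
  by rewrite inE => /eqP; exists A.
pose w (S : {set V}) := pw (block (fun z => z \notin S : nat)) 1.
have eJ : \sum_(t : {perm V}) w (t @^-1: A) = (#|V|`!)%:R.
  rewrite -(J (block_skew (fun z => z \notin A : nat))).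
  by apply: eq_bigr => t _; apply: eq_bigr => y _; rewrite /block !perm1 !inE.
have {eJ} eB : \sum_(S : {set V} | #|S| == s) w S = 'C(#|V|, s)%:R.
  have f0 : (#|V|`!)%:R != 0 :> int by rewrite pnatr_eq0 -lt0n fact_gt0.
  by apply: (mulfI f0); rewrite -(sum_subsets _ cA) eJ.
have wX x : x \in X -> w (desc x) = 2.
  rewrite inE => /and3P[xr ix _].
  rewrite /w /tree_weight (bigD1 x) //= big1 => [|y /andP[yr yx]].
    by rewrite /block !perm1 desc_refl (negbTE (parent_notin Pr dP xr)) /edge_sign ix mulr1.
  rewrite !perm1 /block [y \in _](descE Pr) (negbTE yx) yr /=.
  by case: (P y \in desc x); rewrite subrr mulr0 addr0.
(* Two or more cut edges give a factor 4. With one cut edge, [S] is a subtree, because the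
   complement of a subtree has more than [s] vertices; that subtree points outward, so the weight is
   0. *)
have wN (S : {set V}) : #|S| = s -> S \notin desc @: X -> (4 %| w S)%Z.
  move=> cS nS.
  pose f z := z \notin S.
  have fV : #|f @: V| = 2%N.
    rewrite -card_bool -cardsT; congr #|pred_of_set _|; apply/setP => -[]; rewrite [RHS]inE.
      have /card_gt0P[z] : (0 < #|~: S|)%N by rewrite cardsCs setCK; lia.
      by rewrite inE => zS; apply/imsetP; exists z; rewrite // /f zS.
    have /card_gt0P[z zS] : (0 < #|S|)%N by lia.
    by apply/imsetP; exists z; rewrite // /f zS.
  have := card_classes Pr dP f; rewrite fV ltnS.
  case: (ltngtP 1 #|cross P r f|) => // [c2 _|c1 _].
    have := tree_weight_block P r inw (fun z => z \notin S : nat) 1.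
    apply: dvdz_trans; rewrite -[4]/((2 : int) ^+ 2); apply: dvdz_exp2l.
    apply: leq_trans c2 _; apply/subset_leq_card/subsetP => y.
    by rewrite !inE /= !perm1 /f; case: (y \in S); case: (P y \in S).
  have /cards1P[y ey] : #|cross P r f| == 1%N by rewrite -c1.
  have /[!inE]/andP[yr fy] : y \in cross P r f by rewrite ey set11.
  have c := cut1 Pr dP (f := f) yr.
  have {}c z : f z = if z \in desc y then f y else f r.
    apply: c => y' yr' yy'; apply/eqP; apply: contraT => ne.
    have : y' \in cross P r f by rewrite inE yr'.
    by rewrite ey inE (negbTE yy').
  have frE : f r = ~~ f y.
    move: fy; rewrite [f (P y)]c (negbTE (parent_notin Pr dP yr)).
    by case: (f y); case: (f r).
  have [fyT|fyF] := boolP (f y).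
    have : (#|~: S| <= #|desc y|)%N.
      apply/subset_leq_card/subsetP => z; rewrite inE -/(f z) c.
      by case: ifP => //; rewrite frE fyT.
    have := half yr; have := cardsC S; rewrite cS; lia.
  have eS : S = desc y.
    apply/setP => z; apply: negb_inj; rewrite -/(f z) c frE (negbTE fyF).
    by case: ifP.
  subst S; have iy : ~~ inw y.
    apply: contra nS => iy; apply: imset_f; rewrite inE yr iy cS eqxx //.
  rewrite /w /tree_weight (bigD1 y) //= /block !perm1 desc_refl (negbTE (parent_notin Pr dP yr)).
  by rewrite /edge_sign (negbTE iy) /= mulrBr !mulr1 mulr0 subr0 subrr mul0r dvdz0.
have : (4 %| \sum_(S : {set V} | #|S| == s) w S)%Z.
  rewrite eB dvdzE !natz absz_nat /= cardV.
  by apply: four_dvd_bin; rewrite -?cardV; lia.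
rewrite (bigID [in desc @: X]) /= rpredDr; last first.
  by apply: dvdz_sum => S /andP[/eqP cS nS]; apply: wN.
rewrite (eq_bigl [in desc @: X]); last first.
  move=> S; apply: andb_idl => /imsetP[x + ->]; rewrite inE => /and3P[_ _ //].
rewrite (eq_bigr (fun _ => 2)); last by move=> S /imsetP[x xX ->]; apply: wX.
rewrite sumr_const card_imset; last exact: desc_set_inj.
rewrite -[2 *+ #|_|]mulr_natr dvdzE abszM !natz; move: #|X| => N; clear; lia.
Qed.

End Rooted.

(** * Extracting coefficients, and automorphisms of the undirected tree *)

Lemma poly_int_eq (p q : {poly int}) : (forall z, p.[z] = q.[z]) -> p = q.
Proof.
move=> h; apply/eqP; rewrite -subr_eq0; apply: contraT => ne.
pose s := [seq (i%:Z) | i <- iota 0 (size (p - q))].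
have := @max_poly_roots _ (p - q) s ne.
rewrite size_map size_iota ltnn => -> //.
  by apply/allP => z _; rewrite rootE hornerD hornerN h subrr.
by rewrite map_inj_uniq ?iota_uniq // => a b [].
Qed.

(** Only the factors in [K] have degree 1, so for [m] at least [#|K|] the coefficient is the leading
    one or 0. *)
Lemma coef_prod_linear (I : finType) (A : pred I) (c g : I -> int) (m : nat) :
  let K := [set y | A y && (g y != 0)] in
  (#|K| <= m)%N ->
  (\prod_(y | A y) ((c y)%:P + (g y)%:P * 'X))`_m =
  if #|K| == m then (\prod_(y in K) g y) * \prod_(y | A y && (y \notin K)) c y else 0.
Proof.
move=> K le; rewrite (bigID [in K]) /=.
rewrite (eq_bigl [in K]); last by move=> y; rewrite inE; case: (A y).
rewrite [X in _ * X](eq_bigr (fun y => (c y)%:P)); last first.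
  move=> y /andP[Ay]; rewrite inE Ay /= negbK => /eqP ->.
  by rewrite mul0r addr0.
rewrite -rmorph_prod coefMC.
have gK y : y \in K -> g y != 0 by rewrite inE => /andP[].
have sz y : y \in K -> size ((c y)%:P + (g y)%:P * 'X) = 2%N.
  by move/gK => h; rewrite addrC size_MXaddC polyC_eq0 (negbTE h) size_polyC h.
have lc y : y \in K -> lead_coef ((c y)%:P + (g y)%:P * 'X) = g y.
  by move=> h; rewrite lead_coefE sz //= coefD coefC coefMX coefC /= add0r.
have szP : size (\prod_(y in K) ((c y)%:P + (g y)%:P * 'X)) = #|K|.+1.
  rewrite size_prod; last by move=> y yK; rewrite -size_poly_gt0 sz.
  by rewrite (eq_bigr (fun _ => 2%N)) // sum_nat_const muln2 -addnn -addSn addnK.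
case: eqP => [e|ne].
  congr (_ * _); rewrite -e -[#|K|]/(#|K|.+1.-1) -szP -lead_coefE lead_coef_prod.
  exact: eq_bigr.
by rewrite nth_default ?mul0r // szP; lia.
Qed.

Section Rooted.
Variables (V : finType) (P : V -> V) (d : V -> nat) (r : V).
Hypothesis Pr : P r = r.
Hypothesis dP : forall x, x != r -> (d (P x) < d x)%N.
Variable inw : pred V.
Local Notation desc := (descendants P).
Local Notation pw := (tree_weight P r inw).
Local Notation eps := (edge_sign inw).
Hypothesis J : forall x, skew x -> \sum_(t : {perm V}) pw x t = (#|V|`!)%:R.

(** The contribution of [t] to the coefficient of ['X^m] when the skew function is
    [x0 + 'X * xG]. *)
Definition coefw (x0 xG : V -> V -> int) (m : nat) (t : {perm V}) : int :=
  (\prod_(y | y != r) ((1 + eps y * x0 (t y) (t (P y)))%:P +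
                       (eps y * xG (t y) (t (P y)))%:P * 'X))`_m.

(** By [J] the weight sum is a constant polynomial in the indeterminate. *)
Lemma coefw_sum x0 xG m : skew x0 -> skew xG -> (0 < m)%N ->
  \sum_(t : {perm V}) coefw x0 xG m t = 0.
Proof.
move=> s0 sG m0; rewrite /coefw -coef_sum.
suff -> : \sum_(t : {perm V}) \prod_(y | y != r) ((1 + eps y * x0 (t y) (t (P y)))%:P +
                       (eps y * xG (t y) (t (P y)))%:P * 'X) = ((#|V|`!)%:R)%:P.
  by rewrite coefC; case: m m0.
apply: poly_int_eq => z; rewrite hornerC horner_sum.
rewrite -(J (x := fun a c => x0 a c + z * xG a c)); last first.
  by move=> a c; rewrite s0 sG mulrN opprD.
apply: eq_bigr => t _; rewrite horner_prod; apply: eq_bigr => y _.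
by rewrite !hornerE mulrDr addrA mulrAC mulrA.
Qed.

Lemma eps_neq0 y : eps y != 0. Proof. by rewrite /edge_sign; case: (inw y). Qed.

Definition hit (xG : V -> V -> int) (t : {perm V}) : {set V} :=
  [set y | (y != r) && (xG (t y) (t (P y)) != 0)].

Lemma coefwE x0 xG m t : (#|hit xG t| <= m)%N ->
  coefw x0 xG m t = if #|hit xG t| == m then
    (\prod_(y in hit xG t) (eps y * xG (t y) (t (P y)))) *
    \prod_(y | (y != r) && (y \notin hit xG t)) (1 + eps y * x0 (t y) (t (P y))) else 0.
Proof.
have eK : hit xG t = [set y | (y != r) && (eps y * xG (t y) (t (P y)) != 0)].
  by apply/setP => y; rewrite !inE mulf_eq0 (negbTE (eps_neq0 y)).
by rewrite {1}eK => h; rewrite /coefw coef_prod_linear // -eK.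
Qed.

Definition nbr (a c : V) := ((a != r) && (c == P a)) || ((c != r) && (a == P c)).

(** Put the indeterminate on the tree edges only. In degree n - 1 exactly the placements sending
    every edge to an edge contribute, each with a nonzero term. The total is 0, so the identity is
    not the only one. *)
Lemma nonid_aut : (1 < #|V|)%N ->
  exists2 t : {perm V}, t != 1%g & forall y, y != r -> nbr (t y) (t (P y)).
Proof.
move=> V1.
pose xG a c : int := ((a != r) && (c == P a))%:R - ((c != r) && (a == P c))%:R.
have sG : skew xG by move=> a c; rewrite /xG opprB.
pose m := #|V|.-1.
have cm (t : {perm V}) : (#|hit xG t| <= m)%N.
  rewrite /m -(cardC1 r); apply/subset_leq_card/subsetP => y.
  by rewrite !inE => /andP[].
have h1 : hit xG 1 = [set~ r].
  apply/setP => y; rewrite !inE; have [->|yr] := eqVneq y r => //=.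
  rewrite !perm1 /xG yr eqxx /=.

  by rewrite [y == _]eq_sym (negbTE (no_2cycle Pr dP yr)) andbF.
have c1 : #|hit xG 1| = m by rewrite h1 cardsC1.
have := @coefw_sum (fun _ _ => 0) xG m; rewrite (bigD1 1%g) //= => /(_ _ sG) S.
have {S} : coefw (fun _ _ => 0) xG m 1 + \sum_(i | i != 1%g) coefw (fun _ _ => 0) xG m i = 0.
  by apply: S => [a c|]; [rewrite oppr0|rewrite /m; lia].
have [t /andP[t1 tm] _|no] := pickP (fun t : {perm V} => (t != 1%g) && (#|hit xG t| == m)).
  exists t => // y yr.
  have : hit xG t = [set~ r].
    apply/eqP; rewrite eqEcard cardsC1 (eqP tm) leqnn andbT.
    by apply/subsetP => z; rewrite !inE => /andP[].
  move/setP/(_ y); rewrite !inE yr /= /xG /nbr.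
  by case: (_ && _); case: (_ && _).
rewrite big1 => [|t t1]; last first.
  by rewrite coefwE //; have := no t; rewrite t1 /= => ->.
rewrite addr0 coefwE // c1 eqxx => /eqP; rewrite mulf_eq0 => /orP[/eqP/eqP|].
  case/prodf_eq0 => y; rewrite inE => /andP[yr xy].
  by rewrite mulf_eq0 (negbTE (eps_neq0 y)) (negbTE xy).
by case/prodf_eq0 => y _; rewrite mulr0 addr0.
Qed.

Variable v : V.
Hypothesis vr : v != r.
Hypothesis Pv : P v = r.
Hypothesis cv : (#|desc v|.*2 = #|V|)%N.

(** A subtree not below [v] is disjoint from the half at [v] and also misses the root. *)
Lemma half_lt y : y != r -> y != v -> (#|desc y| < #|desc v|)%N.
Proof.
move=> yr yv; have [h|h] := boolP (y \in desc v); first exact: (card_desc_lt Pr dP).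
have : (#|r |: desc y| <= #|~: desc v|)%N.
  apply/subset_leq_card/subsetP => z; rewrite !inE => /orP[/eqP->|zy].
    by rewrite (root_desc Pr).
  apply: contra h => zv; have := desc_linear Pr dP zy zv => /orP[//|vy].
  move: vy; rewrite (descE Pr) eq_sym (negbTE yv) vr Pv /= (root_desc Pr).
  by rewrite (negbTE yr).
rewrite cardsU1 (root_desc Pr) yr /=; have := cardsC (desc v).
by move: cv; clear; lia.
Qed.

Hypothesis sib : forall x y, x != r -> y != r -> P x = P y -> #|desc x| = #|desc y| -> x = y.

(** The halving edge is the only edge with halves of equal size, so [t] preserves it. If [t] fixed
    its ends it would fix everything, going down the tree, since siblings have subtrees of different
    sizes. *)
Lemma aut_flip (t : {perm V}) : t != 1%g -> (forall y, y != r -> nbr (t y) (t (P y))) ->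
  [/\ t r = v, t v = r & forall y, y != r -> y != v -> t (P y) = P (t y)].
Proof.
move=> t1 ht.
pose f z := t z \in desc v.
have fE y : y != r -> f y != f (P y) -> (t y == r) && (t (P y) == v) || (t y == v) && (t (P y) == r).
  move=> yr; have := ht y yr; rewrite /f /nbr.
  have D a : a != r -> (a \in desc v) != (P a \in desc v) -> a = v.
    move=> ar; rewrite (descE Pr v a) ar /=; have [->//|_] := eqVneq a v.
    by rewrite eqxx.
  case/orP => /andP[nr /eqP e] ne.
    have tv : t y = v by apply: D => //; rewrite -e.
    by rewrite e tv Pv !eqxx orbT.
  have tv : t (P y) = v by apply: D => //; rewrite -e eq_sym.
  by rewrite e tv Pv !eqxx.
(* Look at the edge whose image under [t] is the halving edge; it is shown to be the edge above
   [v]. *)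
have [y0 /andP[y0r fy0]|no] := pickP (fun y => (y != r) && (f y != f (P y))); last first.
  have cst z : f z = f r.
    elim/(up_ind dP): z => // z zr <-.
    by have := no z; rewrite zr /= => /negbFE/eqP.
  have /(_ (t^-1 r)%g) := cst; have := cst (t^-1 v)%g.
  by rewrite /f !permKV desc_refl (root_desc Pr) (negbTE vr) => <-.
have uniq y : y != r -> f y != f (P y) -> y = y0.
  move=> yr fy; have := fE y yr fy; have := fE y0 y0r fy0.
  case/orP => /andP[/eqP a /eqP b] /orP[] /andP[/eqP a' /eqP b'].
  - by apply: (@perm_inj _ t); rewrite a a'.
  - have e1 : y = P y0 by apply: (@perm_inj _ t); rewrite a' b.
    have e2 : y0 = P y by apply: (@perm_inj _ t); rewrite a b'.
    by have := no_2cycle Pr dP yr; rewrite -e2 -e1 eqxx.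
  - have e1 : y = P y0 by apply: (@perm_inj _ t); rewrite a' b.
    have e2 : y0 = P y by apply: (@perm_inj _ t); rewrite a b'.
    by have := no_2cycle Pr dP yr; rewrite -e2 -e1 eqxx.
  - by apply: (@perm_inj _ t); rewrite a a'.
have c z : f z = if z \in desc y0 then f y0 else f r.
  apply: (cut1 Pr dP (f := f) y0r) => y yr yy0; apply/eqP; apply: contraT => /(uniq _ yr) e.
  by rewrite e eqxx in yy0.
have cf : #|[set z | f z]| = #|desc v|.
  by rewrite -[RHS](card_preimset _ (@perm_inj _ t)); apply: eq_card => z; rewrite !inE.
have fr : f r = ~~ f y0.
  move: fy0; rewrite (c (P y0)) (negbTE (parent_notin Pr dP y0r)).
  by case: (f y0); case: (f r).
have y0v : y0 = v.
  apply/eqP; apply: contraT => /(half_lt y0r); rewrite -cf.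
  have [fT|fF] := boolP (f y0).
    rewrite (_ : [set z | f z] = desc y0) ?ltnn //.
    by apply/setP => z; rewrite inE c fr fT; case: ifP.
  rewrite (_ : [set z | f z] = ~: desc y0); last first.
    by apply/setP => z; rewrite !inE c fr (negbTE fF); case: ifP.
  have := cardsC (desc y0); have := cf.
  rewrite (_ : [set z | f z] = ~: desc y0); last first.
    by apply/setP => z; rewrite !inE c fr (negbTE fF); case: ifP.
  by move: cv; clear; lia.
subst y0.
have tuv : (t r == r) && (t v == v) || (t r == v) && (t v == r).
  by have := fE v y0r fy0; rewrite Pv andbC [X in _ || X]andbC orbC.
have com y : y != r -> y != v -> t (P y) = P (t y).
  elim/(up_ind dP): y => [|y yr IH]; rewrite ?eqxx // => _ yv.
  have := ht y yr; case/orP => /andP[nr /eqP e] //.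
  have [Pyr|Pyr] := eqVneq (P y) r.
    rewrite Pyr in nr e *.
    case/orP: tuv => /andP[/eqP a /eqP b]; first by rewrite a eqxx in nr.
    have e' : y = v by apply: (@perm_inj _ t); rewrite b e a Pv.
    by rewrite e' eqxx in yv.
  have [Pyv|Pyv] := eqVneq (P y) v.
    rewrite Pyv in nr e *.
    case/orP: tuv => /andP[/eqP a /eqP b]; last by rewrite b eqxx in nr.
    have e' : y = r by apply: (@perm_inj _ t); rewrite a e b Pv.
    by rewrite e' eqxx in yr.
  have e' : y = P (P y) by apply: (@perm_inj _ t); rewrite e IH.
  by have := no_2cycle Pr dP yr; rewrite -e' eqxx.
(* Only the case where [t] fixes both ends remains to be excluded. *)
case/orP: tuv => /andP[/eqP a /eqP b]; last by split.
exfalso; move/eqP: t1; apply; apply/permP => z; rewrite perm1.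
have dt y z' : y != r -> y != v -> (t z' \in desc (t y)) = (z' \in desc y).
  move=> yr yv.
  have tyr : t y != r by rewrite -a (inj_eq perm_inj).
  have tyv : t y != v by rewrite -b (inj_eq perm_inj).
  elim/(up_ind dP): z' => [|z' zr IH]; first by rewrite a !(root_desc Pr) (negbTE yr) (negbTE tyr).
  have [->|zv] := eqVneq z' v.
    rewrite b !(descE Pr _ v) Pv !(root_desc Pr) (negbTE yr) (negbTE tyr) !andbF !orbF.
    by rewrite eq_sym (negbTE tyv) eq_sym (negbTE yv).
  rewrite (descE Pr) [RHS](descE Pr) (inj_eq perm_inj) -com // IH zr.
  by rewrite -[X in t z' != X]a (inj_eq perm_inj) zr.
elim/(up_ind dP): z => // z zr IH.
have [->//|zv] := eqVneq z v.
apply: sib => //; first by rewrite -[X in _ != X]a (inj_eq perm_inj).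
  by rewrite -com // IH.
rewrite -[RHS](card_imset _ (@perm_inj _ t)); apply: eq_card => w.
rewrite -[w](permKV t) dt // mem_imset //; exact: perm_inj.
Qed.

End Rooted.

(** * The flip [iota] of the halving edge preserves the directions of the other edges *)

Section Mirror.
Variables (V : finType) (P : V -> V) (d : V -> nat) (r : V).
Hypothesis Pr : P r = r.
Hypothesis dP : forall x, x != r -> (d (P x) < d x)%N.
Variable inw : pred V.
Local Notation desc := (descendants P).
Local Notation pw := (tree_weight P r inw).
Local Notation eps := (edge_sign inw).
Hypothesis J : forall x, skew x -> \sum_(t : {perm V}) pw x t = (#|V|`!)%:R.
Variable i0 : nat.
Hypothesis cardV : #|V| = (2 ^ i0)%N.
Variable v : V.
Hypothesis vr : v != r.
Hypothesis Pv : P v = r.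
Hypothesis cv : (#|desc v|.*2 = #|V|)%N.
Hypothesis sib : forall x y, x != r -> y != r -> P x = P y -> #|desc x| = #|desc y| -> x = y.
Variable iota : {perm V}.
Hypothesis iota_r : iota r = v.
Hypothesis iota_v : iota v = r.
Hypothesis iotaP : forall y, y != r -> y != v -> iota (P y) = P (iota y).

Local Notation B := (desc v).

Lemma iota_neq y : y != r -> y != v -> (iota y != r) /\ (iota y != v).
Proof.
move=> yr yv; split; first by rewrite -iota_v (inj_eq perm_inj).
by rewrite -iota_r (inj_eq perm_inj).
Qed.

Lemma iota_desc y z : y != r -> y != v -> (iota z \in desc (iota y)) = (z \in desc y).
Proof.
move=> yr yv; have [iyr iyv] := iota_neq yr yv.
have D a : a != r -> a != v -> v \in desc a = false.
  by move=> ar av; rewrite (descE Pr) Pv (root_desc Pr) (negbTE ar) andbF orbF eq_sym (negbTE av).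
elim/(up_ind dP): z => [|z zr IH].
  by rewrite iota_r D // (root_desc Pr) (negbTE yr).
have [->|zv] := eqVneq z v; first by rewrite iota_v (root_desc Pr) D // (negbTE iyr).
rewrite (descE Pr) [RHS](descE Pr) (inj_eq perm_inj) -iotaP // IH zr.
by rewrite -[inward_roots in iota z != inward_roots]iota_v (inj_eq perm_inj) zv.
Qed.

Lemma iota_side z : (iota z \in B) = (z \notin B).
Proof.
elim/(up_ind dP): z => [|z zr IH].
  by rewrite iota_r desc_refl (root_desc Pr) vr.
have [->|zv] := eqVneq z v; first by rewrite iota_v desc_refl (root_desc Pr) (negbTE vr).
have [izr izv] := iota_neq zr zv.
by rewrite (descE Pr) [in RHS](descE Pr) (negbTE zv) (negbTE izv) zr izr /= -iotaP.
Qed.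

Lemma iota_card_desc y : y != r -> y != v -> #|desc (iota y)| = #|desc y|.
Proof.
move=> yr yv; rewrite -[RHS](card_imset _ (@perm_inj _ iota)); apply: eq_card => wt.
by rewrite -[wt](permKV iota) iota_desc // mem_imset //; exact: perm_inj.
Qed.

(** The action of [iota] on edges named by lower ends: the edge above [v] is mapped to itself with
    ends exchanged, hence the correction by [tperm r v]. *)
Definition edge_perm : {perm V} := (iota * tperm r v)%g.

Lemma edge_perm_edges (rho : rel V) : (forall a c, rho a c = rho c a) ->
  [set y | (y != r) && rho (iota y) (iota (P y))] = edge_perm @^-1: [set y | (y != r) && rho y (P y)].
Proof.
move=> sym; apply/setP => y; rewrite !inE permM.
have [->|yr] /= := eqVneq y r; first by rewrite iota_r tpermR eqxx.
have [->|yv] := eqVneq y v; first by rewrite iota_v Pv iota_r tpermL vr Pv sym.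
have [a b] := iota_neq yr yv.
by rewrite (tpermD _ _) ?a ?iotaP // eq_sym.
Qed.

Lemma card_edge_perm (rho : rel V) : (forall a c, rho a c = rho c a) ->
  #|[set y | (y != r) && rho (iota y) (iota (P y))]| = #|[set y | (y != r) && rho y (P y)]|.
Proof. by move=> /edge_perm_edges ->; rewrite card_preimset //; apply: perm_inj. Qed.

Variable g0 : V.
Hypothesis g0r : g0 != r.
Hypothesis g0B : g0 \notin B.

Local Notation s := #|desc g0|.

Lemma g0v : g0 != v. Proof. by apply: contraNneq g0B => ->; rewrite desc_refl. Qed.

Lemma disjB x z : x != r -> x \notin B -> z \in desc x -> z \notin B.
Proof.
move=> xr xB zx; apply/negP => zB; case/orP: (desc_linear Pr dP zx zB) => h.
  by rewrite h in xB.
move: h; rewrite (descE Pr) Pv (root_desc Pr) (negbTE xr) andbF orbF => /eqP e.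
by rewrite -e desc_refl in xB.
Qed.

(** Labels fall into three parts: 0 for the subtree at [g0], 2 for the half [B], 1 for the rest of
    the root side. *)
Definition part z : nat := if z \in desc g0 then 0%N else if z \in B then 2%N else 1%N.

Lemma part_lt z : (part z < 3)%N.
Proof. by rewrite /part; case: ifP => // _; case: ifP. Qed.

Lemma part0 z : (part z == 0%N) = (z \in desc g0).
Proof. by rewrite /part; case: ifP => // _; case: ifP. Qed.

Lemma part2 z : (part z == 2%N) = (z \in B).
Proof.
rewrite /part; case: ifP => [h|_]; last by case: ifP.
by rewrite (negbTE (disjB g0r g0B h)).
Qed.

Lemma part1 z : (part z == 1%N) = (z \notin desc g0) && (z \notin B).
Proof. by rewrite /part; case: ifP => //= _; case: ifP. Qed.

Lemma part_r : part r = 1%N.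
Proof. by apply/eqP; rewrite part1 !(root_desc Pr) g0r vr. Qed.

Lemma part_v : part v = 2%N.
Proof. by apply/eqP; rewrite part2 desc_refl. Qed.

Lemma part_P b : part b = 1%N -> b != r -> part (P b) = 1%N.
Proof.
move=> /eqP; rewrite part1 => /andP[h1 h2] br; apply/eqP; rewrite part1.
by apply/andP; split; [apply: contra h1|apply: contra h2];
  move=> h; rewrite (descE Pr) br h orbT.
Qed.

(** Each label [b] of part 1 names one label edge: the edge to its parent, or the halving edge if
    [b] is the root. No edge is named twice ([label_edge_excl]). *)
Definition toward b := if b == r then v else P b.
Definition label_edge (a c : V) := ((part a == 1%N) && (c == toward a)) || ((part c == 1%N) && (a == toward c)).

Lemma label_edge_sym a c : label_edge a c = label_edge c a. Proof. by rewrite /label_edge orbC. Qed.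

Lemma label_edge_excl a c : ~~ (((part a == 1%N) && (c == toward a)) && ((part c == 1%N) && (a == toward c))).
Proof.
apply/negP => /andP[/andP[a1 /eqP ec] /andP[c1 /eqP ea]].
move: ea ec; rewrite /toward.
case: (eqVneq a r) => [-> _ e|ar]; first by move: c1; rewrite e part_v.
case: (eqVneq c r) => [-> e|cr]; first by move: a1; rewrite e part_v.
by move=> e1 e2; have := no_2cycle Pr dP ar; rewrite -e2 -e1 eqxx.
Qed.

(** The skew function in use is [cut_x + 'X * edge_x]: the indeterminate marks the label edges,
    while [cut_x] compares parts, leaving the pair [r], [v] to [edge_x]. The coefficient of highest
    degree then counts placements in which every label edge falls on a tree edge. *)
Definition edge_x (a c : V) : int :=
  ((part a == 1%N) && (c == toward a))%:R - ((part c == 1%N) && (a == toward c))%:R.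
Definition cut_x (a c : V) : int :=
  if ((a == r) && (c == v)) || ((a == v) && (c == r)) then 0 else block part a c.

Lemma edge_x_skew : skew edge_x. Proof. by move=> a c; rewrite /edge_x opprB. Qed.
Lemma cut_x_skew : skew cut_x.
Proof.
move=> a c; rewrite /cut_x orbC ![(_ == v) && _]andbC; case: ifP => _; first by rewrite oppr0.
exact: block_skew.
Qed.

Lemma edge_x_pair a c : (edge_x a c != 0) = label_edge a c.
Proof.
by have := label_edge_excl a c; rewrite /edge_x /label_edge; move: ((part a == 1%N) && _) ((part c == 1%N) && _) => [] [].
Qed.

Lemma edge_x_unit a c : label_edge a c -> edge_x a c = 1 \/ edge_x a c = -1.
Proof.
have := label_edge_excl a c; rewrite /edge_x /label_edge.
by move: ((part a == 1%N) && _) ((part c == 1%N) && _) => [] [] //= _ _; [left|right].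
Qed.

Definition hits (t : {perm V}) := [set y | (y != r) && label_edge (t y) (t (P y))].
Definition cuts (t : {perm V}) := [set y | (y != r) && (part (t y) != part (t (P y)))].
Local Notation free_labels := #|[set b | part b == 1%N]|.

Lemma hitE t : hit P r edge_x t = hits t.
Proof. by apply/setP => y; rewrite !inE edge_x_pair. Qed.

Lemma free_labels_eq : (free_labels + s)%N = #|B|.
Proof.
have e : [set b | part b == 1%N] = ~: B :\: desc g0.
  by apply/setP => z; rewrite !inE part1.
have sub : desc g0 \subset ~: B by apply/subsetP => z; rewrite inE; apply: disjB.
rewrite e cardsD (setIidPr sub) subnK ?subset_leq_card //.
by have := cardsC B; rewrite -cv; clear; lia.
Qed.

Lemma s_lt : (s < #|B|)%N.
Proof. exact: (half_lt Pr dP vr Pv cv g0r g0v). Qed.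

Definition hit_label (t : {perm V}) y := if (part (t y) == 1%N) && (t (P y) == toward (t y)) then t y else t (P y).

Lemma hit_labelP t y : y \in hits t ->
  part (hit_label t y) = 1%N /\
  ((t y = hit_label t y /\ t (P y) = toward (hit_label t y)) \/ (t (P y) = hit_label t y /\ t y = toward (hit_label t y))).
Proof.
rewrite inE /label_edge /hit_label => /andP[_]; case: ifP => [/andP[/eqP a /eqP b] _|_ /= /andP[/eqP a /eqP b]].
  by split => //; left.
by split => //; right.
Qed.

Lemma same_edge (t : {perm V}) y y' b c : y != r -> y' != r ->
  ((t y = b /\ t (P y) = c) \/ (t (P y) = b /\ t y = c)) ->
  ((t y' = b /\ t (P y') = c) \/ (t (P y') = b /\ t y' = c)) -> y = y'.
Proof.
move=> yr y'r [] [a1 a2] [] [b1 b2].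
- by apply: (@perm_inj _ t); rewrite a1 b1.
- have e1 : y = P y' by apply: (@perm_inj _ t); rewrite a1 b1.
  have e2 : y' = P y by apply: (@perm_inj _ t); rewrite a2 b2.
  by have := no_2cycle Pr dP yr; rewrite -e2 -e1 eqxx.
- have e1 : y' = P y by apply: (@perm_inj _ t); rewrite a1 b1.
  have e2 : y = P y' by apply: (@perm_inj _ t); rewrite a2 b2.
  by have := no_2cycle Pr dP yr; rewrite -e1 -e2 eqxx.
- by apply: (@perm_inj _ t); rewrite a2 b2.
Qed.

Lemma hit_label_inj t : {in hits t &, injective (hit_label t)}.
Proof.
move=> y y' hy hy' e; have [_ h] := hit_labelP hy; have [_ h'] := hit_labelP hy'.
rewrite -e in h'; move: hy hy'; rewrite !inE => /andP[yr _] /andP[y'r _].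
exact: (same_edge yr y'r h h').
Qed.

Lemma hits_le t : (#|hits t| <= free_labels)%N.
Proof.
rewrite -(card_in_imset (@hit_label_inj t)); apply/subset_leq_card/subsetP => _ /imsetP[y hy ->].
by rewrite inE; have [-> _] := hit_labelP hy.
Qed.

Lemma hits_full t b : #|hits t| = free_labels -> part b = 1%N ->
  exists2 y, y \in hits t & (t y = b /\ t (P y) = toward b) \/ (t (P y) = b /\ t y = toward b).
Proof.
move=> e b1; have : b \in hit_label t @: hits t.
  rewrite (_ : hit_label t @: hits t = [set b | part b == 1%N]) ?inE ?b1 //.
  apply/eqP; rewrite eqEcard (card_in_imset (@hit_label_inj t)) e leqnn andbT.
  by apply/subsetP => _ /imsetP[y hy ->]; rewrite inE; have [-> _] := hit_labelP hy.
by case/imsetP => y hy ->; exists y => //; have [] := hit_labelP hy.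
Qed.

(** The tree edge at [y] receives the labels [r] and [v] of the halving edge. *)
Definition special (t : {perm V}) y :=
  ((t y = r /\ t (P y) = v) \/ (t (P y) = r /\ t y = v)).

(** All label edges except the halving edge stay inside part 1. *)
Lemma hits_cuts t y : y \in hits t -> y \in cuts t -> special t y.
Proof.
move=> hy; have [c1 h] := hit_labelP hy; rewrite inE => /andP[_ ne].
have [e|ner] := eqVneq (hit_label t y) r.
  by move: h; rewrite e /special /toward eqxx.
exfalso; move: h ne; rewrite /toward (negbTE ner).
by have cP := part_P c1 ner; case=> -[-> ->]; rewrite c1 cP eqxx.
Qed.

Lemma special_cuts t y : y != r -> special t y -> y \in cuts t.
Proof. by move=> yr; rewrite inE yr; case=> -[-> ->]; rewrite part_r part_v. Qed.

Lemma special_uniq t y y' : y != r -> y' != r -> special t y -> special t y' -> y = y'.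
Proof. exact: same_edge. Qed.

Lemma special_exists t : #|hits t| = free_labels -> exists2 y, y \in hits t & special t y.
Proof.
by move=> e; have [y hy h] := hits_full e part_r; exists y => //; move: h; rewrite /toward eqxx.
Qed.

(** Three nonempty parts need at least two cut edges in a connected tree. *)
Lemma cuts_ge2 t : (2 <= #|cuts t|)%N.
Proof.
pose f z := part (t z).
have [t0 [a0 b0 _ _]] := class_top Pr dP f (t^-1 g0)%g.
have [t1 [a1 b1 _ _]] := class_top Pr dP f (t^-1 r)%g.
have [t2 [a2 b2 _ _]] := class_top Pr dP f (t^-1 v)%g.
have c0 : part g0 = 0%N by apply/eqP; rewrite part0 desc_refl.
rewrite /f !permKV c0 part_r part_v in b0 b1 b2.
have n01 : t0 != t1 by apply/eqP => e; rewrite e b1 in b0.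
have n02 : t0 != t2 by apply/eqP => e; rewrite e b2 in b0.
have n12 : t1 != t2 by apply/eqP => e; rewrite e b2 in b1.
have : (#|[set t0; t1; t2]| <= #|r |: cuts t|)%N.
  by apply/subset_leq_card/subsetP => z; rewrite !inE => /orP[/orP[]|] /eqP->;
    [move: a0|move: a1|move: a2]; rewrite !inE.
rewrite -setUA cardsU1 cards2 !inE n12 negb_or n01 n02 /= cardsU1.
by case: (_ \notin _) => //; case: #|cuts t|=> [|[|]].
Qed.

Definition wt t := coefw P r inw cut_x edge_x free_labels t.

Lemma free_labels_gt0 : (0 < free_labels)%N.
Proof. by apply/card_gt0P; exists r; rewrite inE part_r. Qed.

Lemma wt_sum : \sum_(t : {perm V}) wt t = 0.
Proof. exact: (coefw_sum J cut_x_skew edge_x_skew free_labels_gt0). Qed.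

Lemma wtE t : wt t = if #|hits t| == free_labels then
    (\prod_(y in hits t) (eps y * edge_x (t y) (t (P y)))) *
    \prod_(y | (y != r) && (y \notin hits t)) (1 + eps y * cut_x (t y) (t (P y))) else 0.
Proof. by rewrite /wt coefwE hitE // hits_le. Qed.

Lemma eps_unit y : eps y = 1 \/ eps y = -1.
Proof. by rewrite /edge_sign; case: (inw y); [left|right]. Qed.

Lemma hits_unit t : let u := \prod_(y in hits t) (eps y * edge_x (t y) (t (P y))) in u = 1 \/ u = -1.
Proof.
apply: (big_ind (fun u : int => u = 1 \/ u = -1)); first by left.
  by move=> a b [->|->] [->|->]; rewrite ?mulr1 ?mulrN1 ?opprK; auto.
move=> y; rewrite inE => /andP[_ /edge_x_unit []] ->; case: (eps_unit y) => ->;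
  by rewrite ?mulr1 ?mulrN1 ?opprK; auto.
Qed.

Lemma cut_x_off t y : y != r -> y \notin hits t -> cut_x (t y) (t (P y)) = block part (t y) (t (P y)).
Proof.
move=> yr; rewrite inE yr /= /cut_x => np; case: ifP => // h; case/negP: np.
case/orP: h => /andP[/eqP -> /eqP ->]; rewrite /label_edge part_r /toward !eqxx //.
by rewrite orbT.
Qed.

Definition tight t := (#|hits t| == free_labels) && (#|cuts t| == 2%N).

(** If all label edges are hit and there are at least three cut edges, at most one of these is a
    hit; each of the others contributes a factor 0 or 2. *)
Lemma wt_dvd4 t : ~~ tight t -> (4 %| wt t)%Z.
Proof.
rewrite wtE /tight; case: eqP => [e /= c2|_ _]; last exact: dvdz0.
apply: dvdz_mull; rewrite (bigID [in cuts t]) /= dvdz_mulr //.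
apply: dvdz_trans (_ : ((2 : int) ^+ #|cuts t :\: hits t| %| _)%Z).
  rewrite -[4]/((2 : int) ^+ 2); apply: dvdz_exp2l.
  have c3 : (3 <= #|cuts t|)%N by have := cuts_ge2 t; move: c2; case: #|cuts t| => [|[|[|]]].
  have : (#|cuts t :&: hits t| <= 1)%N.
    apply/card_le1P => y /setIP[yc yh] y'; apply/idP/idP => [/setIP[y'c y'h]|/eqP->]; last by apply/setIP.
    have yr : y != r by move: yc; rewrite inE => /andP[].
    have y'r : y' != r by move: y'c; rewrite inE => /andP[].
    by rewrite inE; apply/eqP; exact: (special_uniq y'r yr (hits_cuts y'h y'c) (hits_cuts yh yc)).
  by have := cardsID (hits t) (cuts t); move: c3; clear; lia.
rewrite (eq_bigl [in cuts t :\: hits t]); last first.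
  by move=> y; rewrite !inE; case: (y != r); case: (label_edge _ _).
rewrite -prodr_const; apply: (big_ind2 (fun u v => (u %| v)%Z)) => //.
  by move=> u1 u2 v1 v2; exact: dvdz_mul.
move=> y /setDP[yc yh]; have yr : y != r by move: yc; rewrite inE => /andP[].
rewrite cut_x_off // /block; move: yc; rewrite inE yr /=.
by case: (eps_unit y) => ->; case: ltngtP; rewrite //= ?dvdz0.
Qed.

(** One of the two cuts carries the halving edge. The other one, above [x], must separate the labels
    of part 0 from the rest; comparing sizes shows that they lie below [x]. *)
Lemma tight_top t : tight t -> exists x y,
  [/\ x != r, x != v, #|desc x| = s, t @^-1: desc g0 = desc x &
   [/\ y != r, cuts t = [set x; y], y != x, special t y & y \in hits t]].
Proof.
case/andP => /eqP e c2.
have [y yh ys] := special_exists e.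
have yr : y != r by move: yh; rewrite inE => /andP[].
have yc := special_cuts yr ys.
have /cards1P[x ex] : #|cuts t :\ y| == 1%N.
  by move: c2; rewrite (cardsD1 y) yc eqSS.
have ec : cuts t = [set x; y] by rewrite -(setD1K yc) ex setUC.
have [xy xr] : x != y /\ x != r.
  by have := set11 x; rewrite -ex !inE => /and3P[-> ->].
pose f z := t z \in desc g0.
have cc z : z != r -> z != x -> f z = f (P z).
  move=> zr zx; rewrite /f -!part0.
  have [->|zy] := eqVneq z y; first by case: ys => -[-> ->]; rewrite part_r part_v.
  have : z \notin cuts t by rewrite ec !inE negb_or zx.
  by rewrite inE zr /= negbK => /eqP ->.
have {}cc := cut1 Pr dP (f := f) xr cc.
have fr : f r = ~~ f x.
  have [F|F] := boolP (f x); last first.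
    have := cc (t^-1 g0)%g; rewrite {1}/f permKV desc_refl (negbTE F).
    by case: ifP => // _ <-.
  have := cc (t^-1 r)%g; rewrite {1}/f permKV (root_desc Pr) (negbTE g0r) F.
  by case: ifP => // _ <-.
have cp : #|t @^-1: desc g0| = s by rewrite card_preimset //; apply: perm_inj.
have le : (#|desc x| <= #|B|)%N.
  by have [->//|xv] := eqVneq x v; apply/ltnW/(half_lt Pr dP vr Pv cv).
have [F|F] := boolP (f x); last first.
  exfalso; have : t @^-1: desc g0 = ~: desc x.
    by apply/setP => z; rewrite !inE -/(f z) cc fr (negbTE F); case: ifP.
  move=> e2; rewrite e2 in cp; have := cardsC (desc x); have := s_lt.
  by move: cp le cv; clear; lia.
have pe : t @^-1: desc g0 = desc x.
  by apply/setP => z; rewrite !inE -/(f z) cc fr F; case: ifP.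
exists x, y; split => //; try by rewrite -pe.
  by apply: contraTneq s_lt => ev; rewrite -cp pe ev ltnn.
by split => //; rewrite eq_sym.
Qed.

(** Only the cut above [x] gives a factor other than a sign: 2 or 0 according to its direction. *)
Lemma wt_pre t x y : #|hits t| = free_labels -> x != r -> t @^-1: desc g0 = desc x ->
  y != r -> cuts t = [set x; y] -> y != x -> special t y ->
  wt t = (1 + eps x) \/ wt t = - (1 + eps x).
Proof.
move=> e xr pe yr ec yx ys; rewrite wtE e eqxx.
have -> : \prod_(y0 | (y0 != r) && (y0 \notin hits t)) (1 + eps y0 * cut_x (t y0) (t (P y0))) = 1 + eps x.
  have xh : x \notin hits t.
    apply/negP => xh; have xs : special t x by apply: hits_cuts => //; rewrite ec !inE eqxx.
    by case/eqP: yx; apply: (special_uniq yr xr ys xs).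
  rewrite (bigD1 x) ?xr //= big1 ?mulr1 => [|z /andP[/andP[zr zh] zx]].
    rewrite cut_x_off // /block.
    have c0 : part (t x) = 0%N.
      by apply/eqP; rewrite part0; have := desc_refl P x; rewrite -pe inE.
    have : part (t (P x)) != 0%N.
      by rewrite part0; have := parent_notin Pr dP xr; rewrite -pe inE.
    by rewrite c0 ltn0 -lt0n => ->; rewrite subr0 mulr1.
  rewrite cut_x_off //; have : z \notin cuts t.
    rewrite ec !inE negb_or zx /=; apply: contraNneq zh => ->.
    have [y' y'h y's] := special_exists e.
    have y'r : y' != r by move: y'h; rewrite inE => /andP[].
    by rewrite (special_uniq yr y'r ys y's).
  by rewrite inE zr /= negbK /block => /eqP ->; rewrite ltnn subrr mulr0 addr0.
by case: (hits_unit t) => /= ->; rewrite ?mul1r ?mulN1r; auto.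
Qed.


Implicit Types g h t : {perm V}.

(** The symmetries of the labels that preserve the weights: they fix [r], [v], each part as a set,
    and the tree structure of part 1. They act on placements by multiplication on the right. *)
Definition label_group : {set {perm V}} :=
  [set g : {perm V} | [&& g r == r, g v == v, [forall z, part (g z) == part z] &
     [forall z, ((part z == 1%N) && (z != r)) ==> (g (P z) == P (g z))]]].

Lemma label_groupP g : reflect [/\ g r = r, g v = v, forall z, part (g z) = part z &
  forall z, part z = 1%N -> z != r -> g (P z) = P (g z)] (g \in label_group).
Proof.
rewrite inE; apply: (iffP and4P) => [[/eqP a /eqP b /forallP c /forallP e]|[a b c e]]; split => //.
- by move=> z; apply/eqP.
- by move=> z z1 zr; have := e z; rewrite z1 eqxx zr => /eqP.
- exact/eqP.
- exact/eqP.
- by apply/forallP => z; rewrite c.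
- by apply/forallP => z; apply/implyP => /andP[/eqP z1 zr]; rewrite e.
Qed.

Lemma label_group_set : group_set label_group.
Proof.
apply/group_setP; split; first by apply/label_groupP; split => *; rewrite !perm1.
move=> g h /label_groupP[a b c e] /label_groupP[a' b' c' e']; apply/label_groupP; split => *; rewrite !permM.
- by rewrite a a'.
- by rewrite b b'.
- by rewrite c' c.
- by rewrite e // e' ?c // -a (inj_eq perm_inj).
Qed.

Lemma label_group_up g a : g \in label_group -> part a = 1%N -> toward (g a) = g (toward a).
Proof.
case/label_groupP => gr gv gc gP a1; rewrite /toward -[inward_roots in g a == inward_roots]gr (inj_eq perm_inj).
by case: eqP => [_|/eqP ar]; rewrite ?gv // gP.
Qed.

Lemma label_group_half g a c : g \in label_group ->
  (part (g a) == 1%N) && (g c == toward (g a)) = (part a == 1%N) && (c == toward a).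
Proof.
move=> gG; have /label_groupP[_ _ gc _] := gG; rewrite gc.
by case: eqP => // a1; rewrite label_group_up // (inj_eq perm_inj).
Qed.

Lemma label_group_pair g a c : g \in label_group -> label_edge (g a) (g c) = label_edge a c.
Proof. by move=> gG; rewrite /label_edge !(label_group_half _ _ gG). Qed.

Lemma label_group_w g t : g \in label_group -> wt (t * g)%g = wt t.
Proof.
move=> gG; rewrite /wt /coefw; congr ((polyseq _)`_(_)); apply: eq_bigr => y _; rewrite !permM.
have /label_groupP[gr gv gc _] := gG.
have -> : edge_x (g (t y)) (g (t (P y))) = edge_x (t y) (t (P y)) by rewrite /edge_x !(label_group_half _ _ gG).
have -> // : cut_x (g (t y)) (g (t (P y))) = cut_x (t y) (t (P y)).
rewrite /cut_x /block !gc; set b1 := _ || _; set b2 := _ || _; suff -> : b1 = b2 by [].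
rewrite /b1 -{1 2}gr -{1 2}gv !(inj_eq perm_inj) //.
Qed.

Lemma label_group_hits g t : g \in label_group -> hits (t * g)%g = hits t.
Proof. by move=> gG; apply/setP => y; rewrite !inE !permM label_group_pair. Qed.

Lemma label_group_crs g t : g \in label_group -> cuts (t * g)%g = cuts t.
Proof. by case/label_groupP => _ _ gc _; apply/setP => y; rewrite !inE !permM !gc. Qed.

Lemma label_group_pre g t : g \in label_group -> tight (t * g)%g = tight t.
Proof. by move=> gG; rewrite /tight label_group_hits // label_group_crs. Qed.

Lemma label_group_preim g t : g \in label_group -> (t * g)%g @^-1: desc g0 = t @^-1: desc g0.
Proof.
by case/label_groupP => _ _ gc _; apply/setP => y; rewrite !inE permM -!part0 gc.
Qed.

Definition tight_nz : {set {perm V}} := [set t | tight t && (wt t != 0)].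

(** The weights sum to 0, and adding 2 to those of tight placements with nonzero weight makes every
    term a multiple of 4. Summing over orbits of the label group doubles as a count of
    [tight_nz]. *)
Lemma tight_nz_dvd : (#|label_group|.*2 %| #|tight_nz|)%N.
Proof.
have : ((4 * #|label_group|%:R)%R %| (\sum_(t : {perm V}) (wt t + 2 * (t \in tight_nz)%:R))%R)%Z.
  apply: (@orbit_sum_dvd _ (Group label_group_set) xpredT) => // [t g gG|t _].
    by rewrite !inE label_group_w // label_group_pre.
  rewrite inE; have [pt|npt] := boolP (tight t); last by rewrite mulr0 addr0 wt_dvd4.
  have [x [y [xr _ _ pe [yr ec yx ys yh]]]] := tight_top pt.
  have /eqP hd : #|hits t| == free_labels by case/andP: pt.
  by case: (wt_pre hd xr pe yr ec yx ys) => ->; case: (eps_unit x) => ->.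
rewrite big_split /= wt_sum add0r -mulr_sumr -natr_sum.
rewrite -big_mkcond /= sum1_card !natz dvdzE !abszM /= => h.
rewrite -(@dvdn_pmul2l 2) // -mul2n mulnA; exact: h.
Qed.

Definition tight_at x : {set {perm V}} := [set t : {perm V} | tight t && (t @^-1: desc g0 == desc x)].
Definition inward_roots := [set x | [&& x != r, inw x & #|desc x| == s]].

Lemma card_tight_nz : #|tight_nz| = (\sum_(x in inward_roots) #|tight_at x|)%N.
Proof.
under eq_bigr => x _ do rewrite -sum1_card big_mkcond.
rewrite exchange_big /= -sum1_card big_mkcond; apply: eq_bigr => t _.
rewrite inE; have [pt|npt] := boolP (tight t); last first.
  by rewrite big1 // => x _; rewrite inE (negbTE npt).
have [x [y [xr _ xs pe [yr ec yx ys yh]]]] := tight_top pt.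
have /eqP hd : #|hits t| == free_labels by case/andP: pt.
have inZ x' : (t \in tight_at x') = (x' == x).
  rewrite inE pt pe /=; apply/eqP/eqP => [/(desc_set_inj Pr dP)//|-> //].
have -> : (wt t != 0) = (x \in inward_roots).
  rewrite inE xr xs eqxx andbT /=.
  by case: (wt_pre hd xr pe yr ec yx ys) => ->; rewrite /edge_sign; case: (inw x).
case: ifP => xX; last first.
  by rewrite big1 // => x' x'X; rewrite inZ; case: eqP => // e; rewrite -e x'X in xX.
by rewrite (bigD1 x) //= inZ eqxx big1 // => x' /andP[_ ne]; rewrite inZ (negbTE ne).
Qed.

(** The two cuts determine the parts, and sizes decide the rest. If the halving edge stays at [v] it
    keeps its direction, as [B] is too large for what remains on the other side. Otherwise part 1 is
    placed on a subtree inside [B]. *)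
Lemma classify t x : t \in tight_at x -> x != r -> x \notin B ->
  [/\ t r = r, t v = v & forall z, (part (t z) == 2%N) = (z \in B)] \/
  exists y, [/\ y \in B, y != v, t y = r, t (P y) = v & forall z, (part (t z) == 1%N) = (z \in desc y)].
Proof.
rewrite inE => /andP[pt /eqP pe'] xr xB.
have [x1 [y [x1r x1v xs pe [yr ec yx ys yh]]]] := tight_top pt.
have ex : x1 = x by apply: (desc_set_inj Pr dP); rewrite -pe -pe'.
subst x1.
have c0 z : (part (t z) == 0%N) = (z \in desc x) by rewrite part0 -pe inE.
have cS z : z \notin desc x -> part (t z) = if z \in desc y then part (t y) else part (t r).
  elim/(up_ind dP): z => [|z zr IH] zx; first by rewrite (root_desc Pr) (negbTE yr).
  rewrite (descE Pr) zr; have [->//|zy] := eqVneq z y.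
  have zx' : z != x by apply: contraNneq zx => ->; rewrite desc_refl.
  have : z \notin cuts t by rewrite ec !inE negb_or zx'.
  rewrite inE zr /= negbK => /eqP ->; apply: IH.
  by apply: contra zx => h; rewrite (descE Pr) zr h orbT.
have Pyy := parent_notin Pr dP yr.
have yx' : y \notin desc x.
  by rewrite -c0; case: ys => -[a b]; rewrite ?a ?b ?part_r ?part_v.
have Pyx : P y \notin desc x.
  by apply: contra yx' => h; rewrite (descE Pr) yr h orbT.
have cPy : part (t (P y)) = part (t r) by rewrite cS // (negbTE Pyy).
have two : #|[set z | part (t z) == 2%N]| = #|B|.
  rewrite -(card_preimset B (@perm_inj _ t)); apply: eq_card => z.
  by rewrite !inE part2.
have xB' z : z \in B -> z \notin desc x.
  by move=> h; apply/negP => /(disjB xr xB); rewrite h.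
have [yv|yv] := eqVneq y v.
  subst y; left; move: ys; rewrite /special Pv; case=> -[a b]; last first.
    split => // z; have [zx|zx] := boolP (z \in desc x).
      by rewrite (negbTE (disjB xr xB zx)); move: zx; rewrite -c0 => /eqP ->.
    by rewrite cS // a b part_r part_v; case: ifP.
  exfalso; have : (#|[set z | part (t z) == 2%N]| <= #|~: B :\: desc x|)%N.
    apply/subset_leq_card/subsetP => z; rewrite !inE => /eqP e.
    have zx : z \notin desc x by rewrite -c0 e.
    by rewrite zx; move: e; rewrite cS // a b part_r part_v; case: ifP.
  have sub : desc x \subset ~: B by apply/subsetP => z; rewrite inE; apply: disjB.
  rewrite two cardsD (setIidPr sub) xs; have := cardsC B; have := card_desc_gt0 P g0; have := s_lt.
  by move: cv; clear; lia.
have ylt := half_lt Pr dP vr Pv cv yr yv.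
have tworng : part (t r) = 2%N.
  case: ys => -[a b]; first by rewrite -cPy b part_v.
  have cr : part (t r) = 1%N by rewrite -cPy a part_r.
  exfalso; have : (#|[set z | part (t z) == 2%N]| <= #|desc y|)%N.
    apply/subset_leq_card/subsetP => z; rewrite !inE => /eqP e.
    have zx : z \notin desc x by rewrite -c0 e.
    by move: e; rewrite cS // cr; case: ifP.
  by rewrite two leqNgt ylt.
have [ty tPy] : t y = r /\ t (P y) = v.
  by case: ys => -[a b] //; move: tworng; rewrite -cPy a part_r.
have [yB|yB] := boolP (y \in B); last first.
  exfalso; have : (#|r |: B| <= #|[set z | part (t z) == 2%N]|)%N.
    apply/subset_leq_card/subsetP => z; rewrite !inE => /orP[/eqP->|zB].
      by rewrite tworng.
    rewrite cS ?xB' //; case: ifP => [/(disjB yr yB)|_]; first by rewrite zB.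
    by rewrite tworng.
  by rewrite two cardsU1 (root_desc Pr) vr /= ltnn.
right; exists y; split => // z.
have [zx|zx] := boolP (z \in desc x).
  have -> : (z \in desc y) = false.
    by apply/negP => h; have := xB' z (desc_trans h yB); rewrite zx.
  by move: zx; rewrite -c0 => /eqP ->.
by rewrite cS // tworng ty part_r; case: ifP.
Qed.

(** Since all label edges are hit, counting identifies the hit edges as those above [v] and above
    the vertices labelled in part 1, other than the root; then go down from the root. *)
Lemma tight_at_com t x : t \in tight_at x -> x != r -> x \notin B -> t r = r ->
  forall z, part (t z) = 1%N -> z != r -> t (P z) = P (t z).
Proof.
move=> tZ xr xB tr.
have [[_ tv c2]|[y [yB yv ty _ _]]] := classify tZ xr xB; last first.
  have : y = r by apply: (@perm_inj _ t); rewrite ty.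
  by move=> yr; move: yB; rewrite yr (root_desc Pr) (negbTE vr).
move: (tZ); rewrite inE => /andP[/andP[/eqP hd _] /eqP pe].
have c0 z : (part (t z) == 0%N) = (z \in desc x) by rewrite part0 -pe inE.
pose S := [set z | part (t z) == 1%N].
have cS : #|S| = free_labels.
  rewrite -[RHS](card_preimset _ (@perm_inj _ t)); apply: eq_card => z.
  by rewrite !inE.
have rS : r \in S by rewrite inE tr part_r.
have sub : hits t \subset v |: S :\ r.
  apply/subsetP => z zh; have [c1 h] := hit_labelP zh.
  have zr : z != r by move: zh; rewrite inE => /andP[].
  have [zS|zS] := boolP (z \in S); first by rewrite !inE zr; move: zS; rewrite inE => ->; rewrite orbT.
  have e1 : t (P z) = hit_label t z.
    by case: h => -[a b] //; move: zS; rewrite inE a c1.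
  have e2 : t z = toward (t (P z)).
    by rewrite e1; case: h => -[a b] //; move: zS; rewrite inE a c1.
  have PzS : part (t (P z)) = 1%N by rewrite e1.
  rewrite !inE; have [//|zv] := eqVneq z v.
  have : part (t z) = 1%N \/ part (t z) = 2%N.
    rewrite e2 /toward; case: eqP => [_|/eqP ne]; first by right; exact: part_v.
    by left; apply: part_P.
  case=> cz; first by move: zS; rewrite inE cz.
  have := c2 z; rewrite cz eqxx => /esym; rewrite (descE Pr) (negbTE zv) zr /=.
  by rewrite -c2 PzS.
have eh : hits t = v |: S :\ r.
  apply/eqP; rewrite eqEcard sub hd cardsU1 -cS (cardsD1 r S) rS.
  by rewrite leq_add2r; case: (_ \notin _).
move=> z; elim/(up_ind dP): z => [|z zr IH] c1; first by rewrite eqxx.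
move=> _; have zh : z \in hits t by rewrite eh !inE zr c1 eqxx orbT.
have tzr : t z != r by rewrite -tr (inj_eq perm_inj).
move: zh; rewrite inE zr /= /label_edge c1 eqxx /=.
case/orP => [/eqP|/andP[/eqP c1' /eqP e]].
  by rewrite /toward (negbTE tzr).
exfalso; move: e; rewrite /toward; case: eqP => [_ e|/eqP ne].
  by move: c1; rewrite e part_v.
have Pzr : P z != r by apply: contraNneq ne => ->; rewrite tr.
by rewrite -IH // => /perm_inj e; have := no_2cycle Pr dP zr; rewrite -e eqxx.
Qed.

Definition tight_near x := [set t in tight_at x | t r == r].
Definition tight_far x := [set t in tight_at x | t r != r].

(** Such a placement, replaced by the identity on [B], would be an isomorphism between the tree
    pruned at [x] and the tree pruned at [g0]; this is excluded by [pruned_rigid]. *)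
Lemma tight_near_other x : x != r -> x \notin B -> #|desc x| = s -> x != g0 -> tight_near x = set0.
Proof.
move=> xr xB xs ne; apply/setP => t; rewrite in_set0; apply/negP.
rewrite inE => /andP[tZ /eqP tr]; case/eqP: ne.
have com := tight_at_com tZ xr xB tr.
have [[_ tv c2]|[y [yB yv ty _ _]]] := classify tZ xr xB; last first.
  have : y = r by apply: (@perm_inj _ t); rewrite ty.
  by move=> yr; move: yB; rewrite yr (root_desc Pr) (negbTE vr).
move: (tZ); rewrite inE => /andP[_ /eqP pe].
have c0 z : (part (t z) == 0%N) = (z \in desc x) by rewrite part0 -pe inE.
pose al z := if z \in B then z else t z.
have alinj : injective al.
  move=> z z'; rewrite /al; case: ifP => zB; case: ifP => z'B //.
  - by move=> e; move: z'B; rewrite -c2 -e part2 zB.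
  - by move=> e; move: zB; rewrite -c2 e part2 z'B.
  - exact: perm_inj.
apply: (pruned_rigid Pr dP sib (alpha := al) (p := r)) => //; rewrite ?(desc_root Pr dP) //.
- by move=> a b _ _; apply: alinj.
- have dr y : desc r :\: desc y = ~: desc y.
    by apply/setP => z; rewrite in_setD in_setC (desc_root Pr dP) andbT.
  have cC y : #|~: desc y| = (#|V| - #|desc y|)%N by rewrite cardsCs setCK.
  rewrite !dr; apply/eqP; rewrite eqEcard card_imset // !cC xs leqnn andbT.
  apply/subsetP => _ /imsetP[z + ->]; rewrite !in_setC => zx; rewrite /al.
  case: ifP => zB; last by rewrite -part0 c0.
  by apply/negP => h; have := disjB g0r g0B h; rewrite zB.
- by rewrite /al (root_desc Pr) (negbTE vr).
move=> z /setDP[_ zx] zr; rewrite /al; have [zB|zB] := boolP (z \in B).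
  move: (zB); rewrite (descE Pr) zr /= => /orP[/eqP ->|-> //].
  by rewrite Pv (root_desc Pr) (negbTE vr).
have -> : (P z \in B) = false.
  by apply/negP => h; case/negP: zB; rewrite (descE Pr) zr h orbT.
apply: com => //; have := c0 z; have := c2 z; rewrite (negbTE zx) (negbTE zB).
by rewrite /part; case: ifP => //; case: ifP.
Qed.

Lemma tight_near_g0 : tight_near g0 = label_group.
Proof.
apply/setP => t; apply/idP/idP.
  rewrite inE => /andP[tZ /eqP tr].
  have com := tight_at_com tZ g0r g0B tr.
  have [[_ tv c2]|[y [yB yv ty _ _]]] := classify tZ g0r g0B; last first.
    have : y = r by apply: (@perm_inj _ t); rewrite ty.
    by move=> yr; move: yB; rewrite yr (root_desc Pr) (negbTE vr).
  move: (tZ); rewrite inE => /andP[_ /eqP pe].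
  have c z : part (t z) = part z.
    have h0 : (part (t z) == 0%N) = (part z == 0%N) by rewrite !part0 -[in RHS]pe inE.
    have h2 : (part (t z) == 2%N) = (part z == 2%N) by rewrite c2 part2.
    move: h0 h2; rewrite /part; case: (t z \in desc g0); case: (t z \in B);
      by case: (z \in desc g0); case: (z \in B).
  by apply/label_groupP; split => // z z1 zr; apply: com; rewrite ?c.
move=> tG; have /label_groupP[tr tv tc tP] := tG.
have h1 : hits t = hits 1 by rewrite -[t]mul1g label_group_hits.
have cr1 : cuts t = cuts 1 by rewrite -[t]mul1g label_group_crs.
rewrite inE tr eqxx andbT inE; apply/andP; split; last first.
  by apply/eqP/setP => z; rewrite inE -!part0 tc.
apply/andP; split.
  rewrite eqn_leq hits_le h1 /=.
  apply: leq_trans (_ : #|v |: [set b | part b == 1%N] :\ r| <= _)%N.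
    rewrite cardsU1 (cardsD1 r [set b | part b == 1%N]) !inE part_r part_v /= !andbF.
    by rewrite leqnn.
  apply/subset_leq_card/subsetP => z; rewrite !inE !perm1 /label_edge /toward.
  case/orP => [/eqP ->|/andP[zr z1]].
    by rewrite vr Pv part_r !eqxx orbT.
  by rewrite zr z1 (negbTE zr) eqxx.
rewrite eqn_leq cuts_ge2 andbT cr1.
apply: leq_trans (_ : #|[set g0; v]| <= _)%N; last by rewrite cards2; case: (_ != _).
apply/subset_leq_card/subsetP => z; rewrite !inE !perm1 => /andP[zr ne].
apply: contraNT ne; rewrite negb_or => /andP[zg zv].
have [z0|z0] := boolP (part z == 0%N).
  rewrite (eqP z0) eq_sym part0; move: z0; rewrite part0 (descE Pr).
  by rewrite (negbTE zg) => /andP[].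
have [z2|z2] := boolP (part z == 2%N).
  rewrite (eqP z2) eq_sym part2; move: z2; rewrite part2 (descE Pr).
  by rewrite (negbTE zv) => /andP[].
have z1 : part z = 1%N by move: z0 z2; rewrite /part; case: ifP => //; case: ifP.
by rewrite part_P // z1.
Qed.

Definition far_pattern (t : {perm V}) := [exists y, [&& y \in B, y != v, #|desc y| == free_labels, t y == r &
  [forall z, (z \in desc y) ==> ((part (t z) == 1%N) && label_edge (t z) (t (P z)))]]].

Lemma B_parent z y : y \in B -> y != v -> z \in desc y -> z \in B /\ P z \in B.
Proof.
move=> yB yv zy; have zB := desc_trans zy yB; split => //.
move: (zB); rewrite (descE Pr) => /orP[/eqP zv|/andP[]//].
subst z; case/eqP: yv; exact: (desc_anti Pr dP yB zy).
Qed.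

Lemma eq_far_pattern t t' : {in B, t =1 t'} -> far_pattern t = far_pattern t'.
Proof.
move=> e; apply: eq_existsb => y; have [yB|//] := boolP (y \in B).
have [//|yv] := eqVneq y v; rewrite /= e //; do 2!congr (_ && _).
apply: eq_forallb => z; have [zy|//] := boolP (z \in desc y).
by have [zB PzB] := B_parent yB yv zy; rewrite !e.
Qed.

(** Separates the dependence on [x] from [far_pattern], which involves only the restriction of [t]
    to [B]; this allows the count to be moved from [x] to [g0]. *)
Lemma tight_far_char x t : x != r -> x \notin B -> #|desc x| = s ->
  (t \in tight_far x) = (t @^-1: desc g0 == desc x) && far_pattern t.
Proof.
move=> xr xB xs; have BR y : y \in B -> y != r.
  by apply: contraTneq => ->; rewrite (root_desc Pr).
have card1 : #|[set z | part (t z) == 1%N]| = free_labels.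
  rewrite -[RHS](card_preimset _ (@perm_inj _ t)); apply: eq_card => z.
  by rewrite !inE.
apply/idP/andP => [|[/eqP pe /existsP[y /and5P[yB yv /eqP yd /eqP ty /forallP h]]]].
  rewrite inE => /andP[tZ tr]; move: (tZ); rewrite inE => /andP[/andP[/eqP hd _] pe]; split => //.
  have [[e _ _]|[y [yB yv ty tPy c1]]] := classify tZ xr xB; first by rewrite e eqxx in tr.
  have yr := BR y yB.
  have yd : #|desc y| = free_labels by rewrite -card1; apply: eq_card => z; rewrite !inE c1.
  apply/existsP; exists y; rewrite yB yv yd ty !eqxx /=.
  have eh : hits t = desc y.
    apply/eqP; rewrite eqEcard hd yd leqnn andbT; apply/subsetP => z zh.
    have [cz h] := hit_labelP zh; have zr : z != r by move: zh; rewrite inE => /andP[].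
    case: h => -[a _]; first by rewrite -c1 a cz.
    by rewrite (descE Pr) zr -c1 a cz orbT.
  apply/forallP => z; apply/implyP => zy; rewrite c1 zy /=.
  by move: zy; rewrite -eh inE => /andP[].
have yr := BR y yB.
have hz z : z \in desc y -> part (t z) = 1%N /\ label_edge (t z) (t (P z)).
  by move=> zy; have := h z; rewrite zy => /andP[/eqP].
have c1 z : (part (t z) == 1%N) = (z \in desc y).
  suff -> : desc y = [set z | part (t z) == 1%N] by rewrite inE.
  apply/eqP; rewrite eqEcard card1 yd leqnn andbT; apply/subsetP => z' /hz[e _].
  by rewrite inE e.
have c0 z : (part (t z) == 0%N) = (z \in desc x) by rewrite part0 -pe inE.
rewrite inE (_ : t r != r) ?andbT; last first.
  by apply: contra yr => /eqP e; apply/eqP/(@perm_inj _ t); rewrite ty e.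
rewrite inE pe eqxx andbT; apply/andP; split.
  rewrite eqn_leq hits_le -yd /=; apply/subset_leq_card/subsetP => z zy.
  have [_ pz] := hz z zy; rewrite inE pz andbT.
  by apply: contraTneq zy => ->; rewrite (root_desc Pr).
rewrite eqn_leq cuts_ge2 andbT.
apply: leq_trans (_ : #|[set x; y]| <= _)%N; last by rewrite cards2; case: (_ != _).
apply/subset_leq_card/subsetP => z; rewrite !inE => /andP[zr ne].
apply: contraNT ne; rewrite negb_or => /andP[zx zy].
have ex : (z \in desc x) = (P z \in desc x) by rewrite (descE Pr) (negbTE zx) zr.
have ey : (z \in desc y) = (P z \in desc y) by rewrite (descE Pr) (negbTE zy) zr.
have e0 : (part (t z) == 0%N) = (part (t (P z)) == 0%N) by rewrite !c0.
have e1 : (part (t z) == 1%N) = (part (t (P z)) == 1%N) by rewrite !c1.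
have := part_lt (t z); have := part_lt (t (P z)).
by move: (part (t z)) (part (t (P z))) e0 e1 => [|[|[|a]]] [|[|[|b]]].
Qed.

(** Compose with a permutation taking the subtree at [x] to the one at [g0] and fixing [B]
    pointwise. *)
Lemma tight_far_card x : x != r -> x \notin B -> #|desc x| = s -> #|tight_far x| = #|tight_far g0|.
Proof.
move=> xr xB xs; have [k [k1 k2]] := perm_moving xs.
have kB z : z \in B -> k z = z.
  by move=> zB; apply: k2; rewrite inE negb_or; apply/andP; split; apply/negP => h;
    [have := disjB xr xB h|have := disjB g0r g0B h]; rewrite zB.
rewrite -[RHS](card_imset _ (mulgI k)); apply: eq_card => t.
have step t' : ((k * t')%g \in tight_far x) = (t' \in tight_far g0).
  rewrite !tight_far_char //; congr (_ && _); last by apply: eq_far_pattern => z zB; rewrite permM kB.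
  apply/eqP/eqP => e; apply/setP => z.
    have := congr1 (fun S : {set V} => (k^-1)%g z \in S) e.
    by rewrite /= !inE permM permKV -k1 permKV.
  have := congr1 (fun S : {set V} => k z \in S) e.
  by rewrite /= !inE permM k1.
apply/idP/imsetP => [tZ|[t' tZ ->]]; last by rewrite step.
by exists (k^-1 * t)%g; rewrite ?mulKVg // -step mulKVg.
Qed.

Lemma label_group_dvd_far : (#|label_group| %| #|tight_far g0|)%N.
Proof.
have : ((1 * #|label_group|%:R)%R %| (\sum_(t in tight_far g0) (1 : int))%R)%Z.
  apply: (@orbit_sum_dvd _ (Group label_group_set) (fun t => t \in tight_far g0)) => // t g gG.
  rewrite !inE label_group_pre // label_group_preim //; congr (_ && _).
  have /label_groupP[gr _ _ _] := gG.
  by rewrite permM -[inward_roots in g (t r) != inward_roots]gr (inj_eq perm_inj).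
by rewrite sumr_const mul1r !natz dvdzE.
Qed.

(** Composing a placement with [iota] only permutes the tree edges, so the numbers of hits and cuts
    are unchanged. *)
Lemma tight_at_iota x : x != r -> x != v -> #|tight_at (iota x)| = #|tight_at x|.
Proof.
move=> xr xv; rewrite -(card_imset (tight_at (iota x)) (mulgI iota)); apply: eq_card => t; symmetry.
have step t' : ((iota * t')%g \in tight_at x) = (t' \in tight_at (iota x)).
  rewrite !inE /tight; congr (_ && _ && _).
  - rewrite -(card_edge_perm (rho := fun a c => label_edge (t' a) (t' c))) => [|a c]; last exact: label_edge_sym.
    by congr (_ == _); apply: eq_card => z; rewrite !inE !permM.
  - rewrite -(card_edge_perm (rho := fun a c => part (t' a) != part (t' c))) => [|a c]; last by rewrite eq_sym.
    by congr (_ == _); apply: eq_card => z; rewrite !inE !permM.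
  - apply/eqP/eqP => e; apply/setP => z.
      have := congr1 (fun S : {set V} => (iota^-1)%g z \in S) e.
      by rewrite /= !inE permM permKV -(iota_desc _ xr xv) permKV.
    have := congr1 (fun S : {set V} => iota z \in S) e.
    by rewrite /= !inE permM iota_desc.
apply/idP/imsetP => [tZ|[t' tZ ->]]; last by rewrite step.
by exists (iota^-1 * t)%g; rewrite ?mulKVg // -step mulKVg.
Qed.

Lemma tight_at_split x : #|tight_at x| = (#|tight_near x| + #|tight_far x|)%N.
Proof.
rewrite -(cardsID [set t : {perm V} | t r == r] (tight_at x)); congr (_ + _)%N; apply: eq_card => t.
  by rewrite !inE.
by rewrite !inE andbC.
Qed.

Lemma tight_at_A x : x != r -> x \notin B -> #|desc x| = s -> #|tight_at x| = (#|label_group| * (x == g0) + #|tight_far g0|)%N.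
Proof.
move=> xr xB xs; rewrite tight_at_split tight_far_card //; congr (_ + _)%N.
have [->|ne] := eqVneq x g0; first by rewrite muln1 tight_near_g0.
by rewrite muln0 tight_near_other // cards0.
Qed.

Lemma iota_g0 : (iota g0 != r) && (iota g0 != v).
Proof. by have [-> ->] := iota_neq g0r g0v. Qed.

Lemma tight_at_all x : x != r -> #|desc x| = s ->
  #|tight_at x| = (#|label_group| * ((x == g0) + (x == iota g0)) + #|tight_far g0|)%N.
Proof.
move=> xr xs.
have xv : x != v by apply: contraTneq s_lt => e; rewrite -xs e ltnn.
have [xB|xB] := boolP (x \in B); last first.
  rewrite tight_at_A // (_ : (x == iota g0) = false) ?addn0 //.
  by apply: contraNF xB => /eqP ->; rewrite iota_side.
pose x' := (iota^-1 x)%g.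
have ex : iota x' = x by rewrite permKV.
have x'r : x' != r by apply: contraNneq xv => e; rewrite -ex e iota_r.
have x'v : x' != v by apply: contraNneq xr => e; rewrite -ex e iota_v.
have x'B : x' \notin B by rewrite -iota_side ex.
have x's : #|desc x'| = s by rewrite -iota_card_desc // ex.
rewrite -{1}ex tight_at_iota // tight_at_A // -(inj_eq (@perm_inj _ iota)) ex.
rewrite (_ : (x == g0) = false) //.
by apply: contraTF xB => /eqP ->.
Qed.

(** If the directions differed, exactly one of [g0] and [iota g0] would be an inward root. The count
    of [tight_nz] would be [#|label_group|] plus an even multiple of it, because the number of
    inward roots is even, contradicting [tight_nz_dvd]. *)
Lemma mirror_inw : inw g0 = inw (iota g0).
Proof.
apply/eqP; apply: contraT => ne; exfalso.
have e1 : (\sum_(x in inward_roots) (x == g0) + \sum_(x in inward_roots) (x == iota g0) = 1)%N.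
  have cnt y : (\sum_(x in inward_roots) (x == y) = (y \in inward_roots))%N.
    have [yX|yX] := boolP (y \in inward_roots).
      by rewrite (bigD1 y) //= eqxx big1 // => x /andP[_ /negbTE ->].
    by rewrite big1 // => x xX; case: eqP => // e; rewrite -e xX in yX.
  have /andP[ir iv] := iota_g0.
  rewrite !cnt !inE g0r ir iota_card_desc // ?g0v // eqxx !andbT /=.
  by move: ne; case: (inw g0); case: (inw _).
have hV : #|tight_nz| = (#|label_group| + #|inward_roots| * #|tight_far g0|)%N.
  rewrite card_tight_nz (eq_bigr (fun x => #|label_group| * ((x == g0) + (x == iota g0)) + #|tight_far g0|)%N).
    by rewrite big_split /= -big_distrr /= big_split /= e1 muln1 sum_nat_const.
  by move=> x; rewrite inE => /and3P[xr _ /eqP xs]; apply: tight_at_all.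
have evX : ~~ odd #|inward_roots|.
  apply: (even_inward Pr dP J cardV); last 2 first.
  - exact: card_desc_gt0.
  - by rewrite -cv ltn_double s_lt.
  move=> y yr; rewrite -cv leq_double.
  by have [->//|yv] := eqVneq y v; apply/ltnW/(half_lt Pr dP vr Pv cv).
have G0 : (0 < #|label_group|)%N by apply/card_gt0P; exists 1%g; apply: (group1 (Group label_group_set)).
have := tight_nz_dvd; rewrite hV; have /dvdnP[k ->] := label_group_dvd_far.
have /dvdnP[l ->] : (2 %| #|inward_roots|)%N by rewrite dvdn2.
rewrite -mul2n (_ : (_ + _)%N = #|label_group| * (1 + 2 * (l * k)))%N; last by move: #|label_group|; clear; nia.
by rewrite mulnC dvdn_pmul2l // dvdn2 oddD oddM.
Qed.

End Mirror.

(** * Weighted counts of maps and uniform relations *)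

Section EdgeWeight.
Variable R : comNzRingType.

Definition ew (V : finType) (E : rel V) (I : Type) (x : I -> I -> R) (f : V -> I) : R :=
  \prod_a \prod_(b | E a b) (1 + x (f a) (f b)).

Definition homw (V : finType) (E : rel V) (I : finType) (S : {set I}) (x : I -> I -> R) : R :=
  \sum_(f : {ffun V -> I} | f \in ffun_on S) ew E x f.

Lemma eq_ew (V : finType) (E : rel V) (I : Type) (x : I -> I -> R) (f g : V -> I) :
  f =1 g -> ew E x f = ew E x g.
Proof. by move=> e; apply: eq_bigr => a _; apply: eq_bigr => b _; rewrite !e. Qed.

Lemma ew_pairs (V : finType) (E : rel V) (I : Type) (x : I -> I -> R) (f : V -> I) :
  ew E x f = \prod_(e : V * V | E e.1 e.2) (1 + x (f e.1) (f e.2)).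
Proof. by rewrite /ew pair_big_dep. Qed.

Lemma homw_split (V V1 V2 : finType) (E : rel V) (E1 : rel V1) (E2 : rel V2)
    (j : V1 + V2 -> V) (I : finType) (S : {set I}) (x : I -> I -> R) :
  bijective j ->
  (forall a b, E (j (inl a)) (j (inl b)) = E1 a b) ->
  (forall a b, E (j (inr a)) (j (inr b)) = E2 a b) ->
  (forall a b, E (j (inl a)) (j (inr b)) = false) ->
  (forall a b, E (j (inr a)) (j (inl b)) = false) ->
  homw E S x = homw E1 S x * homw E2 S x.
Proof.
case=> k jK kK h1 h2 h12 h21.
rewrite /homw big_distrlr pair_big /=.
pose glue (p : {ffun V1 -> I} * {ffun V2 -> I}) : {ffun V -> I} :=
  [ffun z => match k z with inl a => p.1 a | inr b => p.2 b end].
rewrite (reindex glue) /=; last first.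
  exists (fun f : {ffun V -> I} => ([ffun a => f (j (inl a))], [ffun b => f (j (inr b))])).
    move=> [f g] _; rewrite /glue /=; congr (_, _); apply/ffunP => a; rewrite !ffunE jK //.
  move=> f _; apply/ffunP => z; rewrite ffunE /= -[in RHS](kK z).
  by case: (k z) => a; rewrite ffunE.
apply: eq_big => [[f g]|[f g] _] /=.
  apply/ffun_onP/andP => [h|[/ffun_onP hf /ffun_onP hg] z].
    by split; apply/ffun_onP => a; [have := h (j (inl a))|have := h (j (inr a))]; rewrite ffunE jK.
  by rewrite ffunE; case: (k z) => a.
rewrite /ew (reindex j) /=; last by exists k => z _.
rewrite big_sumType /=; congr (_ * _); apply: eq_bigr => a _.
  rewrite (reindex j) /=; last by exists k => z _.
  rewrite big_sumType /= [X in _ * X]big_pred0 => [|b]; last exact: h12.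
  by rewrite mulr1; apply: eq_big => [b|b _]; rewrite ?h1 // !ffunE !jK.
rewrite (reindex j) /=; last by exists k => z _.
rewrite big_sumType /= [X in X * _]big_pred0 => [|b]; last exact: h21.
by rewrite mul1r; apply: eq_big => [b|b _]; rewrite ?h2 // !ffunE !jK.
Qed.

(** Pair each map [f] with its composition with [iota]. The weights of the remaining edges agree,
    and the factors 1 + x and 1 - x of the edge from [u] to [v] add up to 2; hence the doubled
    statement. *)
Lemma homw_flip (V : finType) (E : rel V) (u v : V) (iota : {perm V})
    (I : finType) (S : {set I}) (x : I -> I -> R) :
  skew x -> E u v -> iota u = v -> iota v = u ->
  let E' := [rel a b | E a b && ((a, b) != (u, v))] in
  (forall a b, E' (iota a) (iota b) = E' a b) ->
  (homw E S x) *+ 2 = (homw E' S x) *+ 2.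
Proof.
move=> sx Euv iu iv E' hE'.
have step f : ew E x f = (1 + x (f u) (f v)) * ew E' x f.
  rewrite !ew_pairs (bigD1 (u, v)) //=; congr (_ * _); apply: eq_bigl => -[a b] //.
rewrite !mulr2n {2}/homw.
rewrite (reindex (fun f : {ffun V -> I} => [ffun z => f (iota z)])) /=; last first.
  exists (fun f : {ffun V -> I} => [ffun z => f ((iota^-1)%g z)]) => f _; apply/ffunP => z;
    by rewrite !ffunE ?permK ?permKV.
rewrite /homw [X in _ + X](eq_bigl [in ffun_on S]); last first.
  move=> f; apply/ffun_onP/ffun_onP => h z; last by rewrite ffunE.
  by have := h ((iota^-1)%g z); rewrite ffunE permKV.
rewrite -!big_split /=; apply: eq_bigr => f _; rewrite !step.
have -> : ew E' x [ffun z => f (iota z)] = ew E' x f.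
  rewrite /ew [RHS](reindex iota) /=; last by exists (iota^-1)%g => z _; rewrite ?permK ?permKV.
  apply: eq_bigr => a _; rewrite [RHS](reindex iota) /=; last by exists (iota^-1)%g => z _; rewrite ?permK ?permKV.
  by apply: eq_big => [b|b _]; rewrite ?ffunE // -[LHS]/(E' a b) -hE'.
rewrite !ffunE iu iv sx -mulrDl.
by rewrite addrACA addNr addr0 mulrDl mul1r.
Qed.

End EdgeWeight.

(** For a random map into [S], the weight has expectation 1, as it does when [x] is 0. This is
    impartiality freed from [n] and from injectivity. *)
Definition uniform (V : finType) (E : rel V) : Prop :=
  forall (I : finType) (S : {set I}) (x : I -> I -> int), skew x -> homw E S x = (#|S| ^ #|V|)%:R.

Lemma uniform_flip (V : finType) (E : rel V) (u v : V) (iota : {perm V}) :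
  E u v -> iota u = v -> iota v = u ->
  let E' := [rel a b | E a b && ((a, b) != (u, v))] in
  (forall a b, E' (iota a) (iota b) = E' a b) -> uniform E <-> uniform E'.
Proof.
move=> Euv iu iv E' hE'.
have key (I : finType) (S : {set I}) (x : I -> I -> int) : skew x -> homw E S x = homw E' S x.
  by move=> sx; apply: (@pmulrnI int 2) => //; apply: homw_flip sx Euv iu iv hE'.
by split=> h I S x sx; rewrite -(h I S x sx) key.
Qed.

Section UniformParts.
Variables (V : finType) (E : rel V).
Hypothesis uE : uniform E.

Lemma uniform_poly (I : finType) (S : {set I}) (x : I -> I -> {poly int}) :
  skew x -> homw E S x = (#|S| ^ #|V|)%:R.
Proof.
move=> sx; apply: poly_int_eq => z; rewrite horner_sum.
rewrite -(rmorph_nat polyC) hornerC.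
rewrite -(uE S (x := fun a b => (x a b).[z])); last by move=> a b; rewrite sx hornerN.
apply: eq_bigr => f _; rewrite /ew horner_prod; apply: eq_bigr => a _.
by rewrite horner_prod; apply: eq_bigr => b _; rewrite !hornerE.
Qed.

End UniformParts.

Lemma homw0 (R : comNzRingType) (V : finType) (E : rel V) (I : finType) (S : {set I}) :
  homw E S (fun _ _ => 0 : R) = (#|S| ^ #|V|)%:R.
Proof.
rewrite -card_ffun_on -sum1_card natr_sum; apply: eq_bigr => f _.
by rewrite /ew big1 // => a _; rewrite big1 // => b _; rewrite addr0.
Qed.

(** Scale [x] by an indeterminate. The weight sums of the two parts multiply to a nonzero constant
    polynomial, so each is constant, and the value at 1 equals the value at 0. *)
Lemma uniform_part (V V1 V2 : finType) (E : rel V) (E1 : rel V1) (E2 : rel V2) (j : V1 + V2 -> V) :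
  bijective j ->
  (forall a b, E (j (inl a)) (j (inl b)) = E1 a b) ->
  (forall a b, E (j (inr a)) (j (inr b)) = E2 a b) ->
  (forall a b, E (j (inl a)) (j (inr b)) = false) ->
  (forall a b, E (j (inr a)) (j (inl b)) = false) ->
  uniform E -> uniform E1.
Proof.
move=> bj h1 h2 h12 h21 uE I S x sx.
have [S0|S0] := posnP #|S|.
  rewrite -(homw0 _ E1); apply: eq_bigr => f /ffun_onP hf.
  apply: eq_bigr => a _; have := hf a; rewrite (cards0_eq S0) inE //.
pose X (a b : I) : {poly int} := (x a b)%:P * 'X.
have sX : skew X by move=> a b; rewrite /X sx polyCN mulNr.
have := homw_split S X bj h1 h2 h12 h21; rewrite (uniform_poly uE) // => e.
set p := homw E1 S X in e.
have pq0 : p * homw E2 S X != 0.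
  by rewrite -e -(rmorph_nat polyC) polyC_eq0 pnatr_eq0 -lt0n expn_gt0 S0.
have sp : size p = 1%N.
  have : size (p * homw E2 S X) = 1%N.
    rewrite -e -(rmorph_nat polyC) size_polyC pnatr_eq0 -lt0n expn_gt0 S0 //.
  move: pq0; rewrite mulf_eq0 negb_or => /andP[p0 q0].
  rewrite size_mul //; move: p0 q0; rewrite -!size_poly_gt0.
  by move: (size p) (size _) => a b; clear; lia.
have /size1_polyC ep : (size p <= 1)%N by rewrite sp.
have hp z : p.[z] = homw E1 S (fun a b => x a b * z).
  rewrite horner_sum; apply: eq_bigr => f _; rewrite /ew horner_prod; apply: eq_bigr => a _.
  by rewrite horner_prod; apply: eq_bigr => b _; rewrite !hornerE.
have := hp 1; rewrite ep hornerC.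
have := hp 0; rewrite {1}ep hornerC => -> e0.
have h (F : I -> I -> int) : (forall a b, F a b = x a b) -> homw E1 S F = homw E1 S x.
  by move=> hF; apply: eq_bigr => f _; apply: eq_bigr => a _; apply: eq_bigr => b _; rewrite hF.
rewrite -(h (fun a b => x a b * 1)) => [|a b]; last by rewrite mulr1.
rewrite -e0 -(homw0 _ E1); apply: eq_bigr => f _; apply: eq_bigr => a _; apply: eq_bigr => b _.
by rewrite mulr0.
Qed.

Lemma uniform_sum (V V1 V2 : finType) (E : rel V) (E1 : rel V1) (E2 : rel V2) (j : V1 + V2 -> V) :
  bijective j ->
  (forall a b, E (j (inl a)) (j (inl b)) = E1 a b) ->
  (forall a b, E (j (inr a)) (j (inr b)) = E2 a b) ->
  (forall a b, E (j (inl a)) (j (inr b)) = false) ->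
  (forall a b, E (j (inr a)) (j (inl b)) = false) ->
  uniform E1 -> uniform E2 -> uniform E.
Proof.
move=> bj h1 h2 h12 h21 u1 u2 I S x sx.
rewrite (homw_split S x bj h1 h2 h12 h21) u1 // u2 // -natrM -expnD.
by rewrite -(bij_eq_card bj) card_sum.
Qed.

(** As the sizes agree, injective means surjective. Inclusion-exclusion over the sets [S] containing
    the image writes the sum through the uniform values, which do not depend on [x]; so it may be
    evaluated at 0. *)
Lemma uniform_inj (V : finType) (E : rel V) (I : finType) (x : I -> I -> int) :
  uniform E -> #|I| = #|V| -> skew x ->
  \sum_(f : {ffun V -> I} | injectiveb f) ew E x f = (#|V|`!)%:R.
Proof.
move=> uE eI sx.
pose c (S : {set I}) : int := \prod_(i | i \notin S) (-1).
have ie (f : {ffun V -> I}) : (injectiveb f)%:R = \sum_(S : {set I}) c S * (f \in ffun_on S)%:R :> int.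
  have -> : (injectiveb f)%:R = \prod_i (1 + - (i \notin codom f)%:R) :> int.
    have [fi|fn] := boolP (injectiveb f).
      rewrite big1 // => i _; suff -> : i \in codom f by rewrite subr0.
      by rewrite (inj_card_onto (injectiveP _ fi)) ?eI.
    have [i hi] : exists i, i \notin codom f.
      apply/existsP; rewrite -negb_forall; apply: contra fn => /forallP h.
      apply/injectiveP; suff : {in [set: V] &, injective f} by move=> h' a b; apply: h'; rewrite inE.
      apply/imset_injP; rewrite cardsT -eI -cardsT; apply/eqP/eq_card => i; rewrite inE.
      by have /codomP[a ->] := h i; rewrite imset_f.
    by rewrite (bigD1 i) //= hi subrr mul0r.
  rewrite bigA_distr; apply: eq_bigr => S _.
  rewrite (bigID [in S]) /= big1 => [|i ->] //; rewrite mul1r.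
  have [/ffun_onP h|h] := boolP (f \in ffun_on S).
    rewrite mulr1 /c; apply: eq_bigr => i iS; rewrite (negbTE iS).
    suff -> : i \notin codom f by [].
    by apply: contra iS => /codomP[a ->].
  have [a ha] : exists a, f a \notin S.
    apply/existsP; rewrite -negb_forall; apply: contra h => /forallP h.
    by apply/ffun_onP.
  by rewrite mulr0 (bigD1 (f a)) //= (negbTE ha) codom_f oppr0 mul0r.
have key (y : I -> I -> int) : skew y ->
  \sum_(f : {ffun V -> I} | injectiveb f) ew E y f = \sum_(S : {set I}) c S * (#|S| ^ #|V|)%:R.
  move=> sy; rewrite big_mkcond /=.
  rewrite (eq_bigr (fun f : {ffun V -> I} => \sum_(S : {set I}) c S * ((f \in ffun_on S)%:R * ew E y f))).
    rewrite exchange_big; apply: eq_bigr => S _; rewrite -mulr_sumr -(uE _ S _ sy).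
    rewrite /homw [in RHS]big_mkcond; congr (_ * _); apply: eq_bigr => f _.
    by case: (_ \in _); rewrite ?mul1r ?mul0r.
  move=> f _; under eq_bigr => S _ do rewrite mulrA.
  by rewrite -mulr_suml -ie; case: (injectiveb f); rewrite ?mul1r ?mul0r.
rewrite key // -(key (fun _ _ => 0)); last by move=> a b; rewrite oppr0.
rewrite (eq_bigr (fun _ => 1)) => [|f _]; last first.
  by rewrite /ew big1 // => a _; rewrite big1 // => b _; rewrite addr0.
rewrite sumr_const; congr _%:R.
rewrite -ffactnn -{1}eI -card_inj_ffuns; apply: eq_card => f.
by rewrite !inE.
Qed.

Lemma uniform_perm (V : finType) (E : rel V) (x : V -> V -> int) :
  uniform E -> skew x -> \sum_(t : {perm V}) ew E x t = (#|V|`!)%:R.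
Proof.
move=> uE sx; rewrite -(uniform_inj uE (erefl #|V|) sx).
rewrite (reindex_onto (@pval V) (insubd (1%g : {perm V}))) /=; last by move=> f fi; exact: (insubdK (1%g : {perm V}) fi).
apply: eq_big => [t|t _]; last by rewrite pvalE.
by rewrite valKd eqxx andbT; have /injectiveP := @perm_inj _ t; rewrite pvalE.
Qed.

(** * Copies in tournaments: impartial means uniform *)

Definition embeddings (H T : digraph) : {set {ffun H -> T}} :=
  [set f : {ffun H -> T} | injectiveb f && [forall u, forall v, edge u v ==> edge (f u) (f v)]].

Definition automorphisms (H : digraph) : {set {ffun H -> H}} :=
  [set f : {ffun H -> H} | injectiveb f && [forall u, forall v, edge (f u) (f v) == edge u v]].

Lemma automorphisms_gt0 (H : digraph) : (0 < #|automorphisms H|)%N.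
Proof.
apply/card_gt0P; exists [ffun u => u]; rewrite inE; apply/andP; split.
  by apply/injectiveP => u v; rewrite !ffunE.
by apply/forallP => u; apply/forallP => v; rewrite !ffunE.
Qed.

(** The embeddings with a given image subgraph differ by exactly one automorphism of [H]. *)
Lemma card_embeddings (H T : digraph) : #|embeddings H T| = (num_copies H T * #|automorphisms H|)%N.
Proof.
pose K (f : {ffun H -> T}) : {set T} * {set T * T} :=
  (f @: [set: H], [set (f e.1, f e.2) | e in [set e : H * H | edge e.1 e.2]]).
have K2 f : f \in embeddings H T -> forall u v, ((f u, f v) \in (K f).2) = edge u v.
  rewrite inE => /andP[/injectiveP fi _] u v; apply/imsetP/idP => [[[a b]]|uv].
    by rewrite inE /= => ab [/fi -> /fi ->].
  by exists (u, v); rewrite ?inE.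
have copyP C : is_copy H C -> exists2 f, f \in embeddings H T & K f = C.
  case: C => C1 C2 /andP[/forallP /= sub /existsP[f /and3P[fi /eqP im /forallP eE]]].
  have {}sub a b : (a, b) \in C2 -> [&& a \in C1, b \in C1 & edge a b].
    by move=> h; have := sub (a, b); rewrite h.
  have {}eE u v : ((f u, f v) \in C2) = edge u v by have := eE u => /forallP/(_ v)/eqP.
  exists f.
    rewrite inE fi; apply/forallP => u; apply/forallP => v; apply/implyP.
    by rewrite -eE => /sub/and3P[].
  congr (_, _) => //; apply/setP => -[a b]; apply/imsetP/idP => [[[u v]]|ab].
    by rewrite inE /= -eE => h [-> ->].
  have /and3P[aC bC _] := sub a b ab.
  move: aC bC ab; rewrite -im => /imsetP[u _ ->] /imsetP[v _ ->]; rewrite eE => uv.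
  by exists (u, v); rewrite ?inE.
have Kcopy f : f \in embeddings H T -> is_copy H (K f).
  move=> fE; move: (fE); rewrite inE => /andP[fi /forallP fh].
  apply/andP; split.
    apply/forallP => e; apply/implyP => /imsetP[[u v] /=]; rewrite inE /= => uv ->.
    by rewrite /= !imset_f //=; have /forallP/(_ v) := fh u; rewrite uv.
  apply/existsP; exists f; rewrite fi eqxx; apply/forallP => u; apply/forallP => v.
  by rewrite (K2 f fE).
rewrite -sum1_card (partition_big K [in [set C | is_copy H C]]) /=; last first.
  by move=> f fE; rewrite inE Kcopy.
rewrite -sum_nat_const; apply: eq_bigr => C; rewrite inE => /copyP[f0 f0E <-].
rewrite sum1_card.
move: (f0E); rewrite inE => /andP[/injectiveP f0i /forallP f0h].
pose g (a : {ffun H -> H}) : {ffun H -> T} := [ffun u => f0 (a u)].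
have gi : injective g.
  by move=> a b /ffunP e; apply/ffunP => u; have := e u; rewrite !ffunE => /f0i.
rewrite -(card_imset _ gi); apply: eq_card => f; rewrite -topredE /=.
apply/andP/imsetP => [[fE /eqP e]|[a]].
  move: (fE); rewrite inE => /andP[/injectiveP fi /forallP fh].
  have cod u : exists w, f0 w == f u.
    have : f u \in (K f0).1 by rewrite -e imset_f.
    by case/imsetP => w _ ->; exists w.
  pose a := [ffun u => xchoose (cod u)].
  have ha u : f0 (a u) = f u by rewrite ffunE; apply/eqP/(xchooseP (cod u)).
  exists a; last by apply/ffunP => u; rewrite ffunE ha.
  rewrite inE; apply/andP; split.
    by apply/injectiveP => u v e'; apply: fi; rewrite -!ha e'.
  apply/forallP => u; apply/forallP => v.
  by rewrite -(K2 f0 f0E) !ha -e (K2 f fE).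
rewrite inE => /andP[/injectiveP ai /forallP ah] ->.
have aE u v : edge (a u) (a v) = edge u v by have /forallP/(_ v)/eqP := ah u.
have ab : bijective a by apply: injF_bij.
have gE : g a \in embeddings H T.
  rewrite inE; apply/andP; split.
    by apply/injectiveP => u v; rewrite !ffunE => /f0i/ai.
  apply/forallP => u; apply/forallP => v; rewrite !ffunE -aE; apply/implyP => uv.
  by have /forallP/(_ (a v))/implyP := f0h (a u); apply.
split=> //; apply/eqP; congr (_, _).
  apply/setP => z; apply/imsetP/imsetP => -[u _ ->].
    by exists (a u); rewrite ?ffunE.
  by case: ab => b _ bK; exists (b u); rewrite ?ffunE ?bK.
apply/setP => z; apply/imsetP/imsetP => -[[u v]]; rewrite inE /= => uv ->.
  by exists (a u, a v); rewrite ?inE /= ?aE ?ffunE.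
case: ab => b _ bK; exists (b u, b v); rewrite /= ?ffunE ?bK // inE /=.
by rewrite -aE !bK.
Qed.

Definition nedges (V : finType) (E : rel V) := #|[set e : V * V | E e.1 e.2]|.

Lemma ew_sign (V : finType) (E : rel V) (I : finType) (x : I -> I -> int) (f : V -> I) :
  (forall a b, E a b -> x (f a) (f b) = 1 \/ x (f a) (f b) = -1) ->
  ew E x f = 2 ^+ nedges E * [forall a, forall b, E a b ==> (x (f a) (f b) == 1)]%:R.
Proof.
move=> hx; rewrite ew_pairs; have [/forallP h|] := boolP [forall a, forall b, E a b ==> (x (f a) (f b) == 1)].
  rewrite mulr1 (eq_bigr (fun _ => 2)) => [|e Ee]; last first.
    by have /forallP/(_ e.2)/implyP/(_ Ee)/eqP -> := h e.1.
  by rewrite prodr_const; congr (_ ^+ _); apply: eq_card => e; rewrite inE.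
rewrite negb_forall => /existsP[a]; rewrite negb_forall => /existsP[b].
rewrite negb_imply => /andP[Eab ne]; rewrite mulr0 (bigD1 (a, b)) //=.
by case: (hx a b Eab) ne => ->; rewrite ?subrr ?mul0r // eqxx.
Qed.

Definition tsign (T : digraph) (a b : T) : int := (edge a b)%:R - (edge b a)%:R.

Lemma tsign_skew T : skew (@tsign T). Proof. by move=> a b; rewrite /tsign opprB. Qed.

(** At the signs of a tournament an injection has weight 2^e if it respects all edges, and 0 as soon
    as one edge is reversed. *)
Lemma sum_tsign (H T : digraph) : tournament T ->
  \sum_(f : {ffun H -> T} | injectiveb f) ew (@edge H) (@tsign T) f =
  2 ^+ nedges (@edge H) * #|embeddings H T|%:R.
Proof.
move=> tT; rewrite -sum1_card natr_sum mulr_sumr big_mkcond [RHS]big_mkcond /=.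
apply: eq_bigr => f _; rewrite inE; case: ifP => //= /injectiveP fi.
have hne a b : edge a b -> f a != f b.
  move=> ab; rewrite (inj_eq fi); apply/eqP => e; have := edge_asym ab; rewrite -e.
  by move: ab; rewrite e => ->.
rewrite ew_sign; last first.
  move=> a b ab; have := tT _ _ (hne a b ab); rewrite /tsign.
  by case: (edge (f a) (f b)); case: (edge (f b) (f a)) => //; auto.
rewrite (_ : [forall a, _] = [forall u, forall v, edge u v ==> edge (f u) (f v)]).
  by case: ifP => _; rewrite ?mulr1 ?mulr0.
apply: eq_forallb => a; apply: eq_forallb => b; have [ab|//] := boolP (edge a b).
have := tT _ _ (hne a b ab); rewrite /= /tsign.
by case: (edge (f a) (f b)); case: (edge (f b) (f a)).
Qed.

Lemma uniform_impartial (H : digraph) : uniform (@edge H) -> impartial H.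
Proof.
move=> uH; exists #|H| => // T1 T2 t1 t2 c1 c2.
apply/eqP; rewrite -(eqn_pmul2r (automorphisms_gt0 H)) -!card_embeddings -(eqr_nat int).
have ne : (2 : int) ^+ nedges (@edge H) != 0 by rewrite expf_neq0.
apply/eqP/(mulfI ne); rewrite -!sum_tsign //.
by rewrite !uniform_inj //; apply: tsign_skew.
Qed.

Section Interpolation.
Variables (V : finType) (E : rel V).
Hypothesis asym : forall u v, E u v -> ~~ E v u.
Variable I : finType.

Definition upd (x : I -> I -> int) a b (t : int) c e : int :=
  if (c == a) && (e == b) then t else if (c == b) && (e == a) then - t else x c e.

Lemma upd_skew x a b t : skew x -> a != b -> skew (upd x a b t).
Proof.
move=> sx ab c e; rewrite /upd [(e == a) && _]andbC [(e == b) && _]andbC.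
case: (boolP ((c == a) && (e == b))) => [/andP[/eqP -> _]|_].
  by rewrite (negbTE ab) opprK.
by case: ifP => _; rewrite // sx.
Qed.

(** As [f] is injective and [E] has no opposite edges, at most one edge is sent to the pair [a],
    [b]. So the weight is affine in that entry and is interpolated from its values at 1 and -1. *)
Lemma ew_upd x a b (f : {ffun V -> I}) : skew x -> a != b -> injective f ->
  ew E x f *+ 2 = (1 + x a b) * ew E (upd x a b 1) f + (1 - x a b) * ew E (upd x a b (-1)) f.
Proof.
move=> sx ab fi; rewrite !ew_pairs.
have rest t (Q : pred (V * V)) :
    (forall e, Q e -> ~~ ((f e.1 == a) && (f e.2 == b)) && ~~ ((f e.1 == b) && (f e.2 == a))) ->
    \prod_(e | Q e) (1 + upd x a b t (f e.1) (f e.2)) = \prod_(e | Q e) (1 + x (f e.1) (f e.2)).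
  move=> hQ; apply: eq_bigr => e /hQ /andP[/negbTE h1 /negbTE h2].
  by rewrite /upd h1 h2.
have asym' u v : E u v -> E v u = false by move/asym/negbTE.
have [e0 /andP[Ee0 /orP h0]|no] :=
    pickP (fun e : V * V => E e.1 e.2 && ((f e.1 == a) && (f e.2 == b) || (f e.1 == b) && (f e.2 == a))); last first.
  rewrite !rest => [||]; first last.
  - by move=> e Ee; have := no e; rewrite Ee /= => /negbT; rewrite negb_or.
  - by move=> e Ee; have := no e; rewrite Ee /= => /negbT; rewrite negb_or.
  by rewrite -mulrDl addrACA subrr addr0 mulrDl mul1r mulr2n.
have others e : E e.1 e.2 && (e != e0) ->
    ~~ ((f e.1 == a) && (f e.2 == b)) && ~~ ((f e.1 == b) && (f e.2 == a)).
  case/andP => Ee ne; rewrite -negb_or; apply: contra ne.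
  have eqe : e.1 = e0.1 -> e.2 = e0.2 -> e == e0.
    by case: (e) => u v; case: (e0) => u' v' /= -> ->.
  have sw : e.1 = e0.2 -> e.2 = e0.1 -> e == e0.
    by move=> s1 s2; move: Ee; rewrite s1 s2 asym'.
  case: h0 => /andP[/eqP p1 /eqP p2] /orP[] /andP[/eqP q1 /eqP q2].
  - by apply: eqe; apply: fi; rewrite ?q1 ?q2.
  - by apply: sw; apply: fi; rewrite ?q1 ?q2.
  - by apply: sw; apply: fi; rewrite ?q1 ?q2.
  - by apply: eqe; apply: fi; rewrite ?q1 ?q2.
rewrite (bigD1 e0) // [in X in _ * X + _](bigD1 e0) // [in X in _ + _ * X](bigD1 e0) //.
rewrite /= (rest 1 _ others) (rest (-1) _ others).
move: (\prod_(i | _) _) => p; rewrite /upd.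
case: h0 => /andP[/eqP -> /eqP ->]; rewrite !eqxx /=; first by ring.
by rewrite eq_sym (negbTE ab) /= (sx b a); ring.
Qed.

Definition sumi (x : I -> I -> int) := \sum_(f : {ffun V -> I} | injectiveb f) ew E x f.

(** Interpolate one entry at a time; the induction is on the number of off-diagonal entries other
    than 1 and -1. *)
Lemma sumi_const (c : int) :
  (forall x, skew x -> (forall a b, a != b -> x a b = 1 \/ x a b = -1) -> sumi x = c) ->
  forall x, skew x -> sumi x = c.
Proof.
move=> hc x; pose bad (x : I -> I -> int) : {set I * I} := [set p | (p.1 != p.2) && (x p.1 p.2 != 1) && (x p.1 p.2 != -1)].
have [n] := ubnP #|bad x|; elim: n x => // n IH x lt sx.
have [[a b]|no] := pickP [in bad x]; last first.
  apply: hc => // a b ab; have := no (a, b); rewrite inE /= ab /=.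
  by move/negbT; rewrite negb_and !negbK => /orP[] /eqP ->; auto.
rewrite inE /= => /andP[/andP[ab n1] n2].
have step t : t = 1 \/ t = -1 -> sumi (upd x a b t) = c.
  move=> ht; apply: IH; last exact: upd_skew.
  apply: (@leq_trans #|bad x|); last by rewrite -ltnS.
  apply/proper_card/properP; split.
    apply/subsetP => -[c' e']; rewrite !inE /upd /=.
    case: ifP => [/andP[/eqP -> /eqP ->]|_]; first by case: ht => ->; rewrite ?eqxx ?andbF.
    by case: ifP => [/andP[/eqP -> /eqP ->]|//]; case: ht => ->; rewrite ?opprK ?eqxx ?andbF.
  exists (a, b); first by rewrite inE /= ab n1.
  by rewrite inE /= /upd !eqxx /=; case: ht => ->; rewrite ?eqxx ?andbF.
apply: (@pmulrnI int 2) => //=.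
rewrite /sumi -sumrMnl (eq_bigr (fun f : {ffun V -> I} => (1 + x a b) * ew E (upd x a b 1) f + (1 - x a b) * ew E (upd x a b (-1)) f)); last first.
  by move=> f /injectiveP fi; apply: ew_upd.
rewrite big_split /= -!mulr_sumr -/(sumi _) -/(sumi _) !step; auto.
by rewrite -mulrDl addrACA subrr addr0 mulrDl mul1r mulr2n.
Qed.

End Interpolation.

(** A map on the image of [f] extends freely to the other points of [B]. *)
Lemma sum_ffun_comp (A B I : finType) (S : {set I}) (f : A -> B) (F : {ffun A -> I} -> int) :
  injective f ->
  \sum_(b : {ffun B -> I} | b \in ffun_on S) F [ffun a => b (f a)] =
  (#|S| ^ (#|B| - #|A|))%:R * \sum_(g : {ffun A -> I} | g \in ffun_on S) F g.
Proof.
move=> fi; rewrite (partition_big (fun b : {ffun B -> I} => [ffun a => b (f a)]) [in ffun_on S]) /=; last first.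
  by move=> b /ffun_onP h; apply/ffun_onP => a; rewrite ffunE.
rewrite mulr_sumr; apply: eq_bigr => g /ffun_onP gS.
rewrite (eq_bigr (fun _ => F g)); last by move=> b /andP[_ /eqP ->].
rewrite sumr_const -[F g *+ _]mulr_natl; congr (_%:R * _).
pose Q i : pred I := fun j => (j \in S) && [forall a, (f a == i) ==> (j == g a)].
have -> : #|[pred b : {ffun B -> I} | (b \in ffun_on S) && ([ffun a => b (f a)] == g)]| = #|family Q|.
  apply: eq_card => b; rewrite inE; apply/andP/familyP => [[/ffun_onP bS /eqP e] i|h].
    rewrite unfold_in /Q bS /=; apply/forallP => a; apply/implyP => /eqP <-.
    by rewrite -e ffunE.
  split; first by apply/ffun_onP => i; have := h i; rewrite unfold_in => /andP[].
  apply/eqP/ffunP => a; rewrite ffunE; have := h (f a); rewrite unfold_in => /andP[_ /forallP/(_ a)].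
  by rewrite eqxx => /eqP.
rewrite card_family foldrE big_map big_enum /= (bigID [in codom f]) /=.
rewrite big1 => [|i /codomP[a ->]]; last first.
  rewrite -(card1 (g a)); apply: eq_card => j; rewrite unfold_in /Q inE.
  apply/andP/eqP => [[_ /forallP/(_ a)]|->]; first by rewrite eqxx => /eqP.
  by split => //; apply/forallP => a'; apply/implyP => /eqP /fi ->.
rewrite mul1n (eq_bigr (fun _ => #|S|)) => [|i ni]; last first.
  apply: eq_card => j; rewrite unfold_in /Q -[RHS]andbT; congr (_ && _).
  apply/forallP => a; apply/implyP => /eqP e; case/negP: ni; rewrite -e; exact: codom_f.
rewrite prod_nat_const; congr (_ ^ _)%N.
have := cardC [in codom f]; rewrite card_codom // => <-.
by rewrite addKn; apply: eq_card => i; rewrite !inE.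
Qed.

(** The sum over injections into n points is the same for all skew [x]; averaging over maps from the
    n points into [S] then removes the injectivity. *)
Lemma impartial_uniform (H : digraph) : impartial H -> uniform (@edge H).
Proof.
case=> n hn imp.
pose G x := sumi (@edge H) (I:='I_n) x.
have sgn x : skew x -> (forall a b : 'I_n, a != b -> x a b = 1 \/ x a b = -1) ->
    exists T : digraph, [/\ tournament T, #|T| = n & G x = 2 ^+ nedges (@edge H) * #|embeddings H T|%:R].
  move=> sx hx.
  have as_ (a b : 'I_n) : (x a b == 1) -> ~~ (x b a == 1).
    by rewrite sx eqr_oppLR => /eqP ->.
  pose T := @Digraph 'I_n (fun a b => x a b == 1) as_.
  have tT : tournament T.
    by move=> a b ab; rewrite /= [x b a]sx; case: (hx a b ab) => ->.
  exists T; split => //; first exact: card_ord.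
  rewrite -sum_tsign //; apply: eq_bigr => f fi; apply: eq_bigr => a _; apply: eq_bigr => b ab.
  have ne : f a != f b.
    rewrite (inj_eq (injectiveP _ fi)); apply/eqP => e; have := edge_asym ab.
    by move: ab; rewrite e => ->.
  congr (1 + _); rewrite /tsign /= [x (f b) (f a)]sx.
  by case: (hx _ _ ne) => ->.
pose x1 : 'I_n -> 'I_n -> int := block (fun a : 'I_n => nat_of_ord a).
have x1s : skew x1 by exact: block_skew.
have x1u (a b : 'I_n) : a != b -> x1 a b = 1 \/ x1 a b = -1.
  by rewrite /x1 /block -val_eqE /=; case: ltngtP => //; auto.
have [T1 [t1 c1 e1]] := sgn x1 x1s x1u.
have cst x : skew x -> G x = G x1.
  move=> sx; apply: sumi_const sx => [|{}x sx hx]; first exact: edge_asym.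
  have [T2 [t2 c2 e2]] := sgn x sx hx.
  by rewrite -/(G x) e1 e2 !card_embeddings (imp T2 T1).
(* The common value is read off at 0, where every weight is 1. *)
have G0 : G x1 = (n ^_ #|H|)%:R.
  rewrite -(cst (fun _ _ => 0)) => [|a b]; last by rewrite oppr0.
  rewrite /G /sumi (eq_bigr (fun _ => 1)) => [|f _]; last first.
    by rewrite /ew big1 // => a _; rewrite big1 // => b _; rewrite addr0.
  rewrite sumr_const; congr _%:R; rewrite -[n in RHS](card_ord n) -card_inj_ffuns.
  by apply: eq_card => f; rewrite !inE.
move=> I S x sx; have [S0|S0] := posnP #|S|.
  rewrite -(homw0 _ (@edge H)); apply: eq_bigr => f /ffun_onP hf.
  by apply: eq_bigr => a _; have := hf a; rewrite (cards0_eq S0) inE.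
have : \sum_(b : {ffun 'I_n -> I} | b \in ffun_on S) G (fun i j => x (b i) (b j)) =
       (#|S| ^ n)%:R * (n ^_ #|H|)%:R.
  rewrite (eq_bigr (fun _ => (n ^_ #|H|)%:R)) => [|b _].
    by rewrite sumr_const card_ffun_on card_ord mulr_natl.
  by rewrite cst // => i j; rewrite sx.
rewrite /G /sumi exchange_big /=.
rewrite (eq_bigr (fun _ => (#|S| ^ (n - #|H|))%:R * homw (@edge H) S x)) => [|f /injectiveP fi]; last first.
  have := sum_ffun_comp S (fun g : {ffun H -> I} => ew (@edge H) x g) fi; rewrite card_ord => <-.
  apply: eq_bigr => b _; apply: eq_bigr => u _; apply: eq_bigr => v _.
  by rewrite !ffunE.
rewrite sumr_const -[_ *+ _]mulr_natr.
have := card_inj_ffuns H 'I_n; rewrite card_ord cardsE => ->.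
(* The number of injections can be cancelled because [#|H| <= n]. *)
move=> /mulIf; rewrite pnatr_eq0 -lt0n ffact_gt0 => /(_ hn).
rewrite -{2}(subnK hn) expnD natrM => /mulfI; apply.
by rewrite pnatr_eq0 -lt0n expn_gt0 S0.
Qed.

(** * A connected uniform digraph is a tree with a mirror symmetry *)

Definition adj (V : finType) (E : rel V) : rel V := fun a b => E a b || E b a.

Section Tree.
Variables (V : finType) (E : rel V).
Hypothesis asym : forall u v, E u v -> ~~ E v u.
Hypothesis uE : uniform E.
Hypothesis conn : forall x y, connect (adj E) x y.

(** With the signs of a linear order every permutation has weight 0 or 2^e. *)
Lemma nedges_dvd : (2 ^ nedges E %| #|V|`!)%N.
Proof.
pose x : V -> V -> int := block (fun a => enum_rank a).
have sx : skew x by exact: block_skew.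
have : (((2 : int) ^+ nedges E)%R %| ((#|V|`!)%:R : int)%R)%Z.
  rewrite -(uniform_perm uE sx); apply: dvdz_sum => t _; rewrite ew_sign ?dvdz_mulr // => a b ab.
  have : t a != t b.
    rewrite (inj_eq perm_inj); apply/eqP => e; have := asym ab.
    by move: ab; rewrite e => ->.
  rewrite -(inj_eq enum_rank_inj) -val_eqE /x /block /=; case: ltngtP => //; auto.
by rewrite natz dvdzE abszX.
Qed.

Lemma nedges_lt : (0 < #|V|)%N ->
  (nedges E < #|V|)%N /\ (nedges E = #|V|.-1 -> exists i, #|V| = (2 ^ i)%N).
Proof.
move=> V0; have [h1 h2] := logn2_fact V0.
have le : (nedges E <= logn 2 #|V|`!)%N.
  by rewrite -pfactor_dvdn ?fact_gt0 // nedges_dvd.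
split; first exact: leq_ltn_trans le h1.
move=> e; apply: h2; apply/eqP; rewrite eqn_leq -{2}e le andbT.
by move: h1; case: #|V| V0.
Qed.

(** [P] is a step towards [r] along a shortest path. The n - 1 parent edges already exhaust [E],
    which has fewer than n edges. So [ew] becomes [tree_weight]. *)
Lemma spanning_tree (r : V) : exists (P : V -> V) (d : V -> nat),
  [/\ P r = r, forall x, x != r -> (d (P x) < d x)%N,
      forall a b, adj E a b = nbr P r a b &
      nedges E = #|V|.-1 /\
      forall x (t : {perm V}), skew x -> ew E x t = tree_weight P r (fun y => E y (P y)) x t].
Proof.
have ex x : exists k, [exists p : k.-tuple V, path (adj E) r p && (last r p == x)].
  have /connectP[p pp ->] := conn r x.
  by exists (size p); apply/existsP; exists (in_tuple p); rewrite /= pp eqxx.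
pose d x := ex_minn (ex x).
have dmin x p : path (adj E) r p -> last r p = x -> (d x <= size p)%N.
  move=> pp lp; rewrite /d; case: (ex_minnP (ex x)) => m _; apply.
  by apply/existsP; exists (in_tuple p); rewrite /= pp lp eqxx.
have par x : exists y, (x == r) && (y == r) || [&& x != r, adj E y x & d y < d x]%N.
  have [->|xr] := eqVneq x r; first by exists r; rewrite eqxx.
  have [p [pp lp sp]] : exists p, [/\ path (adj E) r p, last r p = x & size p = d x].
    rewrite /d; case: (ex_minnP (ex x)) => m /existsP[p /andP[pp /eqP lp]] _.
    by exists p; rewrite size_tuple.
  case/lastP: p sp pp lp => [|p y] sp /=; first by move=> _ e; rewrite e eqxx in xr.
  rewrite rcons_path last_rcons => /andP[pp ay] e; subst y; exists (last r p).
  by rewrite ay /= -sp size_rcons ltnS; apply: dmin.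
pose P x := xchoose (par x).
have hP x := xchooseP (par x); rewrite -/(P _) in hP.
have {}hP x : (x == r) && (P x == r) || [&& x != r, adj E (P x) x & d (P x) < d x]%N by exact: hP.
have Pr : P r = r by have := hP r; rewrite eqxx orbF => /eqP.
have hP' x : x != r -> adj E (P x) x /\ (d (P x) < d x)%N.
  by move=> xr; have := hP x; rewrite (negbTE xr) /= => /andP[].
have dP x : x != r -> (d (P x) < d x)%N by move/hP'=> [].
pose o x := if E x (P x) then (x, P x) else (P x, x).
have oE x : x != r -> E (o x).1 (o x).2.
  by move=> /hP' [+ _]; rewrite /o /adj; case: ifP => [|_] /=; rewrite ?orbF.
have oi : {in [set~ r] &, injective o}.
  move=> x y; rewrite !inE => xr yr; rewrite /o; case: ifP => _; case: ifP => _ [] //.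
    by move=> e1 e2; have := no_2cycle Pr dP xr; rewrite e2 -e1 eqxx.
  by move=> e1 e2; have := no_2cycle Pr dP xr; rewrite e1 -e2 eqxx.
have V0 : (0 < #|V|)%N by apply/card_gt0P; exists r.
have [lt _] := nedges_lt V0.
have co : #|o @: [set~ r]| = #|V|.-1 by rewrite card_in_imset // cardsC1.
have im : o @: [set~ r] = [set e : V * V | E e.1 e.2].
  apply/eqP; rewrite eqEcard co; apply/andP; split; last by rewrite -ltnS prednK.
  by apply/subsetP => _ /imsetP[x + ->]; rewrite !inE => xr; apply: oE.
have EP a b : E a b -> nbr P r a b.
  move=> ab; have : (a, b) \in o @: [set~ r] by rewrite im inE.
  case/imsetP => x; rewrite !inE => xr; rewrite /o /nbr; case: ifP => _ [-> ->].
    by rewrite xr eqxx.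
  by rewrite xr eqxx orbT.
exists P, d; split => //.
  move=> a b; apply/idP/idP.
    by case/orP => /EP //; rewrite /nbr orbC.
  case/orP => /andP[xr /eqP ->]; have [+ _] := hP' _ xr => //.
  by rewrite /adj orbC.
split; first by rewrite -co im.
move=> x t sx; rewrite ew_pairs (eq_bigl [in o @: [set~ r]]); last by move=> e; rewrite im inE.
rewrite big_imset //= /tree_weight; apply: eq_big => [y|y _]; first by rewrite !inE.
rewrite /o /edge_sign; case: ifP => _ /=; first by rewrite mul1r.
by rewrite sx mulN1r.
Qed.

(** Find the halving edge from an arbitrary root, then root the tree again at its tail. The subtree
    at its head is one of the two old halves. *)
Lemma center : (1 < #|V|)%N -> exists (r v : V) (P : V -> V) (d : V -> nat),
  [/\ E r v, P r = r, forall x, x != r -> (d (P x) < d x)%N,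
      forall a b, adj E a b = nbr P r a b &
      [/\ forall x (t : {perm V}), skew x -> ew E x t = tree_weight P r (fun y => E y (P y)) x t,
          v != r, P v = r, (#|descendants P v|.*2 = #|V|)%N & exists i, #|V| = (2 ^ i)%N]].
Proof.
move=> V1; have V0 := ltnW V1; have /card_gt0P[r0 _] := V0.
have [P0 [d0 [Pr0 dP0 adj0 [ne0 ew0]]]] := spanning_tree r0.
have [_ /(_ ne0) [i ci]] := nedges_lt V0.
have J0 x : skew x -> \sum_(t : {perm V}) tree_weight P0 r0 (fun y => E y (P0 y)) x t = (#|V|`!)%:R.
  by move=> sx; rewrite -(uniform_perm uE sx); apply: eq_bigr => t _; rewrite ew0.
have [|c cr0 cc] := balanced Pr0 dP0 J0 ci.
  by case: i ci V1 => // ->.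
have ac : adj E c (P0 c) by rewrite adj0 /nbr cr0 eqxx.
have [r [v [Erv hrv]]] : exists r v, E r v /\ ((r = c /\ v = P0 c) \/ (r = P0 c /\ v = c)).
  by case/orP: ac => h; [exists c, (P0 c)|exists (P0 c), c]; split; auto.
have vr : v != r by apply/eqP => e; have := asym Erv; move: Erv; rewrite e => ->.
have [P [d [Pr dP adjP [_ ewP]]]] := spanning_tree r.
have Pv : P v = r.
  have : adj E r v by rewrite /adj Erv.
  by rewrite adjP /nbr eqxx /= => /andP[_ /eqP].
exists r, v, P, d; split => //; split => //; last by exists i.
pose f z := z \in descendants P0 c.
have flip a : a != r0 -> f a != f (P0 a) -> a = c.
  move=> ar; rewrite /f (descE Pr0 c a) ar; have [//|_] := eqVneq a c.
  by rewrite eqxx.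
have cst y : y != r -> y != v -> f y = f (P y).
  move=> yr yv; apply/eqP; apply: contraT => ne.
  have : adj E y (P y) by rewrite adjP /nbr yr eqxx.
  rewrite adj0 => /orP[/andP[yr0 /eqP e]|/andP[Pyr0 /eqP e]].
    rewrite e in ne; have yc := flip y yr0 ne.
    by case: hrv yr yv => -[-> ->]; rewrite yc eqxx.
  have ne2 : f (P y) != f (P0 (P y)) by rewrite -e eq_sym.
  have yc := flip (P y) Pyr0 ne2; rewrite yc in e.
  by case: hrv yr yv => -[-> ->]; rewrite e eqxx.
have {}cst := cut1 Pr dP (f := f) vr cst.
have frv : f r = ~~ f v.
  have fc : f c by exact: desc_refl.
  have fPc : f (P0 c) = false by apply/negbTE/(parent_notin Pr0 dP0).
  by case: hrv => -[-> ->]; rewrite fc fPc.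
have [fv|fv] := boolP (f v).
  rewrite (_ : descendants P v = descendants P0 c) //; apply/setP => z.
  by rewrite -[RHS]/(f z) cst frv fv; case: ifP.
have e : descendants P v = ~: descendants P0 c.
  by apply/setP => z; rewrite inE -[z \in descendants P0 c]/(f z) cst frv (negbTE fv); case: ifP.
by rewrite e; have := cardsC (descendants P0 c); move: cc; clear; lia.
Qed.

(** Gathers what the induction needs, without reference to a root or parent map; the last clause
    gives the connectedness of the root half. *)
Lemma mirror_structure : (1 < #|V|)%N -> exists (r v : V) (B : {set V}) (iota : {perm V}),
  [/\ E r v, r \notin B, forall z, (iota z \in B) = (z \notin B),
      iota r = v & [/\ forall z, iota (iota z) = z,
      forall a b, E a b -> (a, b) != (r, v) -> (a \in B) = (b \in B),
      forall a b, (E (iota a) (iota b) && ((iota a, iota b) != (r, v))) = (E a b && ((a, b) != (r, v))) &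
      forall z, z \notin B -> exists2 p, path (adj E) z p & (last z p = r) /\ all [predC B] p]].
Proof.
move=> V1; have [r [v [P [d [Erv Pr dP adjP [ewP vr Pv cv [i ci]]]]]]] := center V1.
pose inw y := E y (P y).
have J x : skew x -> \sum_(t : {perm V}) tree_weight P r inw x t = (#|V|`!)%:R.
  by move=> sx; rewrite -(uniform_perm uE sx); apply: eq_bigr => t _; rewrite ewP.
have sib := sibling Pr dP J ci.
have [iota n1 hn] := nonid_aut Pr dP J V1.
have [ir iv iP] := aut_flip Pr dP vr Pv cv sib n1 hn.
(* The square is again an automorphism of the tree; it fixes [r], so by [aut_flip] it is trivial. *)
have ii z : iota (iota z) = z.
  suff e : (iota * iota)%g = 1%g by rewrite -permM e perm1.
  apply/eqP; apply: contraT => n2.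
  have [|+ _ _] := aut_flip Pr dP vr Pv cv sib n2.
    move=> y yr; rewrite !permM; have [->|yv] := eqVneq y v.
      by rewrite iv Pv !ir iv /nbr vr Pv eqxx.
    have [yr' yv'] := iota_neq ir iv yr yv.
    have [yr'' _] := iota_neq ir iv yr' yv'.
    by rewrite iP // iP // /nbr yr'' eqxx.
  by rewrite permM ir iv => e; rewrite e eqxx in vr.
have side := iota_side Pr dP vr ir iv iP.
have inwi y : y != r -> y != v -> inw (iota y) = inw y.
  move=> yr yv; have [yB|yB] := boolP (y \in descendants P v); last first.
    by rewrite -(mirror_inw Pr dP J ci vr Pv cv sib ir iv iP yr yB).
  have [yr' yv'] := iota_neq ir iv yr yv.
  by rewrite (mirror_inw Pr dP J ci vr Pv cv sib ir iv iP yr' _) ?ii // side yB.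
pose E' a b := E a b && ((a, b) != (r, v)).
have E'E a b : E' a b = [&& a != r, a != v, b == P a & inw a] || [&& b != r, b != v, a == P b & ~~ inw b].
  rewrite /E'; apply/andP/orP => [[ab ne]|].
    have : nbr P r a b by rewrite -adjP /adj ab.
    case/orP => /andP[nr /eqP e]; [left|right].
      rewrite nr /= /inw -e ab eqxx !andbT; apply: contraTneq ab => av.
      by rewrite e av Pv; apply: asym.
    rewrite nr /= /inw -e (asym ab) eqxx !andbT; apply: contraNneq ne => bv.
    by rewrite e bv Pv.
  case=> /and4P[nr nv /eqP e]; rewrite /inw e.
    by move=> ->; split => //; rewrite xpair_eqE (negbTE nr).
  move=> nb; split; last by rewrite xpair_eqE (negbTE nv) andbF.
  have : adj E b (P b) by rewrite adjP /nbr nr eqxx.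
  by rewrite /adj (negbTE nb).
have Bpar a : a != r -> a != v -> (a \in descendants P v) = (P a \in descendants P v).
  by move=> ar av; rewrite (descE Pr v a) ar (negbTE av).
exists r, v, (descendants P v), iota; split => //; first by rewrite (root_desc Pr).
split => //.
- move=> a b ab ne; have : E' a b by rewrite /E' ab.
  rewrite E'E => /orP[] /and4P[nr nv /eqP -> _]; first exact: Bpar.
  by rewrite -Bpar.
- move=> a b; rewrite -/(E' _ _) -/(E' a b) !E'E.
  have nri z : (iota z != r) = (z != v) by rewrite -iv (inj_eq perm_inj).
  have nvi z : (iota z != v) = (z != r) by rewrite -ir (inj_eq perm_inj).
  have half w z : [&& iota w != r, iota w != v, iota z == P (iota w) & inw (iota w)] = [&& w != r, w != v, z == P w & inw w].
    rewrite nri nvi andbCA; have [//|wr] := eqVneq w r; have [//|wv] := eqVneq w v.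
    by rewrite /= -iP // (inj_eq perm_inj) inwi.
  have half' w z : [&& iota w != r, iota w != v, iota z == P (iota w) & ~~ inw (iota w)] = [&& w != r, w != v, z == P w & ~~ inw w].
    rewrite nri nvi andbCA; have [//|wr] := eqVneq w r; have [//|wv] := eqVneq w v.
    by rewrite /= -iP // (inj_eq perm_inj) inwi.
  by rewrite half half'.
elim/(up_ind dP) => [|z zr IH] zB; first by exists [::].
have PzB : P z \notin descendants P v by apply: contra zB => h; rewrite (descE Pr) zr h orbT.
have [p pp [lp ap]] := IH PzB; exists (P z :: p); rewrite /= ?pp ?PzB //.
by rewrite adjP /nbr zr eqxx.
Qed.

End Tree.

(* Assembling recursively bridge-mirrored digraphs and disjoint unions *)
Local Close Scope ring_scope.

Lemma inj_surj_bij (A : choiceType) (B : eqType) (f : A -> B) :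
  injective f -> (forall b, exists a, f a == b) -> bijective f.
Proof.
move=> fi sf; exists (fun b => xchoose (sf b)) => [a|b].
  by apply: fi; apply/eqP; exact: (xchooseP (sf (f a))).
by apply/eqP; exact: (xchooseP (sf b)).
Qed.

Section Induced.
Variables (H : digraph) (S : {set H}).

Lemma induced_asym (u v : {x : H | x \in S}) : edge (val u) (val v) -> ~~ edge (val v) (val u).
Proof. exact: edge_asym. Qed.

Definition induced : digraph :=
  @Digraph {x : H | x \in S} (fun u v => edge (val u) (val v)) induced_asym.

End Induced.

Lemma uniform_closed (V : finType) (E : rel V) (S : {set V}) :
  (forall a b, E a b -> (a \in S) = (b \in S)) -> uniform E ->
  uniform (fun u v : {x | x \in S} => E (val u) (val v)).
Proof.
move=> cl uE.
pose j (s : {x | x \in S} + {x | x \notin S}) : V := match s with inl a => val a | inr b => val b end.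
have bj : bijective j.
  apply: inj_surj_bij => [[[x h]|[x h]] [[y h']|[y h']] /= e|x].
  - by congr inl; apply: val_inj.
  - by exfalso; move: (h'); rewrite -e h.
  - by exfalso; move: (h); rewrite e h'.
  - by congr inr; apply: val_inj.
  case: (boolP (x \in S)) => h; first by exists (inl (exist _ x h)).
  by exists (inr (exist _ x h)).
apply: (@uniform_part _ _ _ E _ (fun u v : {x | x \notin S} => E (val u) (val v)) j) => //=.
  by move=> [a ha] [b hb] /=; apply/negP => /cl; rewrite ha (negbTE hb).
by move=> [a ha] [b hb] /=; apply/negP => /cl; rewrite hb (negbTE ha).
Qed.

Lemma uniform_iso (G H : digraph) : isomorphic G H -> uniform (@edge H) -> uniform (@edge G).
Proof.
case=> f [[g fK gK] ef].
(* An isomorphic copy is treated as a part whose complement is empty. *)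
pose j (s : G + void) : H := match s with inl a => f a | inr b => match b with end end.
apply: (@uniform_part _ _ _ _ _ (fun _ _ : void => false) j) => //.
by exists (fun h => inl (g h)) => [[]|] //= a; rewrite fK.
Qed.

Lemma uniform_no_edge (V : finType) (E : rel V) : (forall a b, E a b = false) -> uniform E.
Proof.
move=> nE I S x _; rewrite -(homw0 _ E); apply: eq_bigr => f _; apply: eq_bigr => a _.
by rewrite !big_pred0.
Qed.

(** Exchanging the two copies swaps the ends of the bridge and preserves the other edges, so
    [uniform_flip] reduces to two disjoint copies of [T]. *)
Lemma rbm_uniform (H : digraph) : recursively_bridge_mirrored H -> uniform (@edge H).
Proof.
elim=> {H} [H H1|T r H _ uT iso].
  apply: uniform_no_edge => a b; have e : a = b.
    by apply: (fintype_le1P _ _) ; rewrite H1.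
  by apply/negP => ab; have := edge_asym ab; move: ab; rewrite e => ->.
apply: uniform_iso iso _.
pose iota_fun (p : bool * T) := (~~ p.1, p.2).
have iota_inj : injective iota_fun by move=> [b x] [c y] [/(can_inj negbK) -> ->].
pose iota := perm iota_inj.
pose E' (a b : bool * T) := bridge_mirror_edge r a b && ((a, b) != ((false, r), (true, r))).
have E'E a b : E' a b = (a.1 == b.1) && edge a.2 b.2.
  case: a b => [c x] [d y]; rewrite /E' /bridge_mirror_edge !xpair_eqE /=.
  by case: c; case: d; rewrite /= ?andbF ?andbT ?orbF //; case: (x == r); case: (y == r).
have h a b : E' (iota a) (iota b) = E' a b.
  by rewrite !E'E !permE /=; case: a.1; case: b.1.
apply/(@uniform_flip _ _ (false, r) (true, r) iota); rewrite ?permE //=.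
  by rewrite /bridge_mirror_edge !eqxx orbT.
pose j (s : T + T) : bool * T := match s with inl a => (false, a) | inr b => (true, b) end.
apply: (@uniform_sum _ _ _ _ (@edge T) (@edge T) j) => //; try by move=> a b; rewrite [LHS]E'E.
by exists (fun p : bool * T => if p.1 then inr p.2 else inl p.2) => [[]|[[]]].
Qed.

Lemma union_uniform k (F : 'I_k -> digraph) :
  (forall i, uniform (@edge (F i))) -> uniform (@edge (disjoint_union F)).
Proof.
elim: k F => [|k IH] F uF; first by apply: uniform_no_edge => -[[]].
pose F' i := F (lift ord0 i).
pose j (s : F ord0 + disjoint_union F') : disjoint_union F :=
  match s with inl a => Tagged (fun i => vertex (F i)) a
             | inr u => Tagged (fun i => vertex (F i)) (tagged u : F (lift ord0 (tag u))) end.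
apply: (@uniform_sum _ _ _ _ (@edge (F ord0)) (@edge (disjoint_union F')) j) => //.
- apply: inj_surj_bij.
    case=> [a|[i x]] [b|[i' x']] /eqP; rewrite /j -tag_eqE /tag_eq /=.
    + by rewrite tagged_asE => /eqP ->.
    + by [].
    + by [].
    + by case/andP=> /eqP/lift_inj e; subst i'; rewrite tagged_asE => /eqP ->.
  case=> i x; case: (unliftP ord0 i) x => [i' ->|->] x.
    by exists (inr (Tagged (fun i => vertex (F' i)) x)).
  by exists (inl x).
- by move=> a b; rewrite /= /disjoint_union_edge /= ?eqxx tagged_asE.
- move=> [i x] [i' x']; rewrite /= /disjoint_union_edge /= (inj_eq lift_inj).
  by case: eqP => // e; subst i'; rewrite !tagged_asE.
- by apply: IH => i; apply: uF.
Qed.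

Lemma card_induced (H : digraph) (S : {set H}) : #|induced S| = #|S|.
Proof. by rewrite card_sig. Qed.

(** Deleting the halving edge keeps the digraph uniform, so the half containing [r] is uniform,
    connected and smaller. By induction it is bridge-mirrored, and [iota] identifies the other half
    with it. *)
Lemma uniform_connected_rbm (H : digraph) :
  uniform (@edge H) -> (forall x y, connect (adj (@edge H)) x y) -> 0 < #|H| ->
  recursively_bridge_mirrored H.
Proof.
have [n] := ubnP #|H|; elim: n H => // n IH H ltn uH conn H0.
have [H1|H1] := leqP #|H| 1.
  by apply: rbm_vertex; apply/eqP; rewrite eqn_leq H1.
have [r [v [B [iota [Erv rB side ir [ii cross inv down]]]]]] :=
  mirror_structure (@edge_asym H) uH conn H1.
have vB : v \in B by rewrite -ir side.
have iv : iota v = r by rewrite -ir ii.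
have sE a b : a \notin B -> b \notin B -> (edge a b && ((a, b) != (r, v))) = edge a b.
  move=> _ bB; rewrite xpair_eqE; have [e|] := eqVneq b v; last by rewrite andbF andbT.
  by rewrite e vB in bB.
have uE' := iffLR (uniform_flip Erv ir iv inv) uH.
pose A := ~: B.
have rA : r \in A by rewrite inE.
have clA a b : edge a b && ((a, b) != (r, v)) -> (a \in A) = (b \in A).
  by case/andP => ab ne; rewrite !inE (cross a b).
have uA : uniform (@edge (induced A)).
  have := uniform_closed clA uE'; move=> h I S x sx; rewrite -(h I S x sx).
  apply: eq_bigr => f _; apply: eq_bigr => a _; apply: eq_bigl => b.
  have := valP a; have := valP b; rewrite !inE => hb ha.
  by rewrite [RHS]sE.
have cA : #|induced A| < #|H|.
  rewrite card_induced -cardsT; apply/proper_card/properP; split; first exact: subsetT.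
  by exists v; rewrite ?inE // vB.
have connA : forall x y, connect (adj (@edge (induced A))) x y.
  have sym : connect_sym (adj (@edge (induced A))).
    by apply: sym_connect_sym => x y; rewrite /adj orbC.
  have toR x : connect (adj (@edge (induced A))) x (exist _ r rA : induced A).
    have := valP x; rewrite inE => /down[p pp [lp ap]].
    elim: p x pp lp ap => [|y p IHp] x /=.
      by move=> _ e _; rewrite (_ : x = exist _ r rA) ?connect0 //; apply: val_inj.
    case/andP=> xy pp lp /andP[yB ap].
    have yA : y \in A by rewrite inE.
    apply: connect_trans (connect1 _) (IHp (exist _ y yA) pp lp ap).
    exact: xy.
  by move=> x y; apply: connect_trans (toR x) _; rewrite sym.
have rbmA : recursively_bridge_mirrored (induced A).
  apply: IH => //; first exact: leq_trans cA _.
  by apply/card_gt0P; exists (exist _ r rA).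
apply: (rbm_bridge (T := induced A) (r := exist _ r rA)) => //.
pose h (p : bridge_mirror (exist _ r rA : induced A)) : H :=
  if p.1 then iota (val p.2) else val p.2.
have notB (a : induced A) : val a \notin B by have := valP a; rewrite inE.
have hb : bijective h.
  apply: inj_surj_bij => [[[] a] [[] b]|z]; rewrite /h /=.
  - by move=> /perm_inj/val_inj ->.
  - move=> e; have := notB b; rewrite (_ : val b = iota (val a)) ?side ?notB //.
  - move=> e; have := notB a; rewrite (_ : val a = iota (val b)) ?side ?notB //.
  - by move=> /val_inj ->.
  have [zB|zB] := boolP (z \in B).
    have zA : iota z \in A by rewrite inE side negbK.
    by exists (true, exist _ (iota z) zA); rewrite /= ii.
  have zA : z \in A by rewrite inE.
  by exists (false, exist _ z zA).
have hE p q : edge (h p) (h q) = edge p q.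
  case: p q => [b1 a] [b2 c]; rewrite /h /= /bridge_mirror_edge !xpair_eqE /= -!val_eqE /=.
  case: b1; case: b2 => /=; rewrite ?orbF.
  - rewrite -(sE _ _ (notB a) (notB c)) -inv.
    rewrite xpair_eqE (_ : (iota (val a) == r) = false) ?andbT //.
    by apply/eqP => e; have := side (val a); rewrite e notB (negbTE rB).
  - apply/negP => ac; have := cross _ _ ac; rewrite side notB (negbTE (notB c)).
    rewrite xpair_eqE (_ : (iota (val a) == r) = false) //; first by move=> /(_ isT).
    by apply/eqP => e; have := side (val a); rewrite e notB (negbTE rB).
  - apply/idP/andP => [ac|[/eqP -> /eqP ->]]; last by rewrite ir.
    have [[ea ec]|ne] := eqVneq (val a, iota (val c)) (r, v); last first.
      by have := cross _ _ ac ne; rewrite side notB (negbTE (notB a)).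
    by split; apply/eqP => //; apply: (@perm_inj _ iota); rewrite ec ir.
  - by rewrite ?andbF ?orbF.
case: hb => h' hK h'K; exists h'; split; first by exists h.
by move=> a b; rewrite -hE !h'K.
Qed.

Lemma component_tag (H : digraph) (x y : H) : edge x y -> fingraph.root (adj (@edge H)) x = fingraph.root (adj (@edge H)) y.
Proof.
move=> xy; have sym : connect_sym (adj (@edge H)).
  by apply: sym_connect_sym => a b; rewrite /adj orbC.
by apply/(fingraph.rootP sym); apply: connect1; rewrite /adj xy.
Qed.

Lemma uniform_union (H : digraph) : uniform (@edge H) -> is_disjoint_union_of_rbm H.
Proof.
move=> uH; pose e := adj (@edge H).
have sym : connect_sym e by apply: sym_connect_sym => a b; rewrite /e /adj orbC.
(* Components are indexed by their canonical representatives. *)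
pose R : finType := {x : H | fingraph.root e x == x}.
pose C (i : 'I_#|R|) : {set H} := [set x | fingraph.root e x == val (enum_val i)].
pose F (i : 'I_#|R|) := induced (C i).
exists #|R|, F; split.
  move=> i; pose r0 := val (enum_val i).
  have r0C : r0 \in C i by rewrite inE; exact: (valP (enum_val i)).
  apply: uniform_connected_rbm.
  - apply: uniform_closed uH => a b ab.
    by rewrite !inE /e (component_tag ab).
  - have symF : connect_sym (adj (@edge (F i))).
      by apply: sym_connect_sym => x y; rewrite /adj orbC.
    have toR x (xC : x \in C i) : connect (adj (@edge (F i))) (exist _ x xC) (exist _ r0 r0C).
      have : connect e x r0.
        by move: (xC); rewrite inE -/r0 => /eqP <-; exact: connect_root.
      case/connectP => p; elim: p x xC => [|y p IHp] x xC /=.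
        by move=> _ er; rewrite (_ : exist _ x xC = exist _ r0 r0C) ?connect0 //; apply: val_inj.
      case/andP=> xy pp er.
      have yC : y \in C i.
        move: xC; rewrite !inE => /eqP <-; apply/eqP/esym/(fingraph.rootP sym); exact: connect1.
      by apply: connect_trans (connect1 _) (IHp y yC pp er).
    move=> [x xC] [y yC]; apply: connect_trans (toR x xC) _.
    by rewrite symF; exact: toR.
  - by apply/card_gt0P; exists (exist _ r0 r0C).
pose g (u : disjoint_union F) : H := val (tagged u).
have gC (u : disjoint_union F) : fingraph.root e (g u) = val (enum_val (tag u)).
  by case: u => i [x xC]; rewrite /g /=; have := xC; rewrite inE => /eqP.
have tagP u u' : fingraph.root e (g u) = fingraph.root e (g u') -> tag u = tag u'.
  by rewrite !gC => /val_inj/enum_val_inj.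
have gb : bijective g.
  apply: inj_surj_bij => [u u' eg|x].
    have := tagP u u' (congr1 (fingraph.root e) eg); case: u eg => i a; case: u' => i' a' /= eg ei.
    by subst i'; congr existT; apply: val_inj.
  have rx : fingraph.root e (fingraph.root e x) == fingraph.root e x by rewrite fingraph.root_root.
  pose i := enum_rank (exist _ (fingraph.root e x) rx : R).
  have xC : x \in C i by rewrite inE /i enum_rankK.
  by exists (existT (fun i => vertex (F i)) i (exist _ x xC)).
have gE u u' : edge (g u) (g u') = edge u u'.
  have [ei|ne] := eqVneq (tag u) (tag u').
    case: u u' ei => i a [i' a'] /= ei; subst i'.
    by rewrite /disjoint_union_edge /= eqxx tagged_asE.
  rewrite /= /disjoint_union_edge (negbTE ne) /=; apply/negP => /component_tag/tagP e'.
  by rewrite e' eqxx in ne.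
case: gb => h gK hK; exists h; split; first by exists g.
by move=> a b; rewrite -gE !hK.
Qed.

Theorem theorem1p4 (H : digraph) :
  impartial H <-> is_disjoint_union_of_rbm H.
Proof.
split=> [/impartial_uniform/uniform_union //|[k [F [hF iso]]]].
apply: uniform_impartial; apply: uniform_iso iso _.
by apply: union_uniform => i; apply: rbm_uniform.
Qed.
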